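(* The functional $\mathcal{J}_\Gamma:Y_\Gamma\to\mathbb{R}$ is differentiable with gradient $$\nabla\mathcal{J}_\Gamma(\mathbf{p}_\Gamma)=\frac1\alpha\,\mathrm{div}^*\left(\mathrm{div}(\mathcal{H}_I\mathbf{p}_\Gamma\oplus\mathbf{p}_\Gamma)+\alpha f\right)\Big|_{Y_\Gamma},$$ which is Lipschitz continuous (with respect to $\|\cdot\|_{Y_\Gamma}$) with a Lipschitz constant $4/\alpha$.
   Context: Discretization. $\Omega=(0,M)\times(0,N)$ is the domain of an $M\times N$ image; $\mathcal{T}$ is the collection of the pixels, the unit squares $T_{ij}=(i-1,i)\times(j-1,j)$, $1\le i\le M$, $1\le j\le N$. $\alpha>0$ is a fixed parameter. $X$ is the space of $u\in L^2(\Omega)$ that are constant on each $T\in\mathcal{T}$, with inner product $\langle u,v\rangle_X=\int_\Omega uv\,dx=\sum_{T}(u)_T(v)_T$, where $(u)_T$ is the value of $u$ on $T$; $f\in X$ is a given image. $H(\mathrm{div};\Omega)=\{\mathbf{p}\in(L^2(\Omega))^2:\mathrm{div}\,\mathbf{p}\in L^2(\Omega)\}$, and $H_0(\mathrm{div};\Omega)$ is its subspace of fields with vanishing normal component on $\partial\Omega$. $\mathcal{RT}_0(T)$ is the set of fields on $T$ of the form $(a_1+b_1x_1,\,a_2+b_2x_2)$, and $Y=\{\mathbf{q}\in H_0(\mathrm{div};\Omega):\mathbf{q}|_T\in\mathcal{RT}_0(T)\ \forall T\in\mathcal{T}\}$. The degrees of freedom of $\mathbf{q}\in Y$ are the (constant)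 values $(\mathbf{q})_i$ of $\mathbf{q}\cdot\mathbf{n}$ on the interior pixel edges $i\in\mathcal{I}$ (edges shared by two pixels), with $\mathbf{n}$ the unit normal in the positive coordinate direction; $\{\boldsymbol{\psi}_i\}_{i\in\mathcal{I}}$ is the corresponding dual basis, so $\mathbf{q}=\sum_i(\mathbf{q})_i\boldsymbol{\psi}_i$. $Y$ has the Euclidean inner product $\langle\mathbf{p},\mathbf{q}\rangle_Y=\sum_{i\in\mathcal{I}}(\mathbf{p})_i(\mathbf{q})_i$. $\mathrm{div}$ maps $Y$ into $X$; $\mathrm{div}^*:X\to Y$ is its adjoint: $\langle\mathrm{div}^*u,\mathbf{p}\rangle_Y=\langle u,\mathrm{div}\,\mathbf{p}\rangle_X$. $\mathcal{J}(\mathbf{p})=\frac1{2\alpha}\int_\Omega(\mathrm{div}\,\mathbf{p}+\alpha f)^2dx$. Domain decomposition. $\Omega$ is decomposed in a checkerboard fashion into a $K\times K$ array of disjoint square subdomains $\{\Omega_s\}_{s=1}^{\mathcal{N}}$, $\mathcal{N}=K\times K$, each a union of pixels (up to edges), each consisting of at least $2\times2$ pixels. $\Gamma=\bigcup_{s<t}\Gamma_{st}$, $\Gamma_{st}=\partial\Omega_s\cap\partial\Omega_t$ for adjacent subdomains. $\mathcal{T}_s$ is the set of pixels in $\Omega_s$, $Y_s=\{\mathbf{q}_s\in H_0(\mathrm{div};\Omega_s):\mathbf{q}_s|_T\in\mathcal{RT}_0(T)\ \forall T\in\mathcal{T}_s\}$, with basis index set $\mathcal{I}_s$ (pixel edges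 interior to $\Omega_s$); $Y_I=\bigoplus_sY_s$. $\mathcal{I}_\Gamma\subset\mathcal{I}$ is the set of edges on $\Gamma$, and $Y_\Gamma=\mathrm{span}\{\boldsymbol{\psi}_i\}_{i\in\mathcal{I}_\Gamma}$. Extending by zero, $Y=Y_I\oplus Y_\Gamma$; $\mathbf{p}|_{Y_\Gamma}$ denotes the $Y_\Gamma$-component of $\mathbf{p}\in Y$, and all spaces carry the Euclidean inner product/norm inherited from $Y$. $C_s=\{\mathbf{p}_s\in Y_s:|(\mathbf{p}_s)_i|\le1\ \forall i\in\mathcal{I}_s\}$, $C_I=\bigoplus_sC_s$. $\chi_S$ is $0$ on $S$ and $+\infty$ off $S$. For $\mathbf{p}_\Gamma\in Y_\Gamma$, $\mathcal{H}_I\mathbf{p}_\Gamma\in C_I$ denotes any minimizer of $\mathbf{p}_I\mapsto\mathcal{J}(\mathbf{p}_I\oplus\mathbf{p}_\Gamma)+\chi_{C_I}(\mathbf{p}_I)$ over $Y_I$ (its divergence is uniquely determined), and $\mathcal{J}_\Gamma(\mathbf{p}_\Gamma)=\mathcal{J}(\mathcal{H}_I\mathbf{p}_\Gamma\oplus\mathbf{p}_\Gamma)$. *)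

(* Defs.v *)
From mathcomp Require Import all_boot all_order all_algebra.
From mathcomp Require Import all_classical all_reals all_analysis.

Set Implicit Arguments.
Unset Strict Implicit.
Unset Printing Implicit Defensive.

Import Order.TTheory GRing.Theory Num.Theory.
Import numFieldNormedType.Exports.

Local Open Scope classical_set_scope.
Local Open Scope ring_scope.

(* Elements of L^2 spaces are represented by functions on the whole plane, of
   which only the restriction to the domain D, up to null sets, matters. *)

Definition field (R : realType) := (R * R -> R * R)%type.

Section HdivSpaces.
Context {R : realType}.
Notation plane_measure :=
  (@lebesgue_measure R \x @lebesgue_measure R)%E.
Implicit Types (D : set (R * R)) (p : R * R -> R * R) (g phi u v : R * R -> R).

Definition integral_on D u : R := \int[plane_measure]_(x in D) u x.

Definition L2 D u : Prop :=
  measurable_fun D u /\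
  (\int[plane_measure]_(x in D) ((u x ^+ 2)%:E) < +oo)%E.

Definition e1 : R * R := (1, 0).
Definition e2 : R * R := (0, 1).

Definition C1 phi : Prop :=
  [/\ forall x, differentiable phi x,
      continuous (fun x => 'D_e1 phi x) &
      continuous (fun x => 'D_e2 phi x)].

Definition C1c D phi : Prop :=
  C1 phi /\ exists2 A, compact A /\ A `<=` D & forall x, ~ A x -> phi x = 0.

Definition dot_grad p phi : R * R -> R :=
  fun x => (p x).1 * 'D_e1 phi x + (p x).2 * 'D_e2 phi x.

Definition is_weak_div D p g : Prop :=
  L2 D g /\
  forall phi, C1c D phi ->
    integral_on D (dot_grad p phi) = - integral_on D (fun x => g x * phi x).

Definition Hdiv D p : Prop :=
  [/\ L2 D (fun x => (p x).1), L2 D (fun x => (p x).2) &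
      exists g, is_weak_div D p g].

(* Meaningful when Hdiv D p; then it is determined up to a null subset of D. *)
Definition div D p : R * R -> R := get (is_weak_div D p).

(* The pairing of the normal trace of p with the restriction of phi to the
   boundary of D, as given by Green's formula. *)
Definition normal_trace D p phi : R :=
  integral_on D (fun x => dot_grad p phi x + div D p x * phi x).

Definition H0div D p : Prop :=
  Hdiv D p /\ forall phi, C1 phi -> normal_trace D p phi = 0.

Definition RT0 D p : Prop :=
  exists a1 b1 a2 b2 : R,
    forall x, D x -> p x = (a1 + b1 * x.1, a2 + b2 * x.2).

Definition boundary D : set (R * R) := closure D `\` interior D.

(* The indicator function of convex analysis: 0 on S, +oo off S. *)
Definition chi (T : Type) (S : set T) (x : T) : \bar R :=
  if `[< S x >] then 0%E else +oo%E.

End HdivSpaces.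

Section Discretization.
Context {R : realType} (M N : nat).
Implicit Types (p q : field R) (u v : R * R -> R).

Definition Omega : set (R * R) := `]0, M%:R[ `*` `]0, N%:R[.

(* Indices start at 0: pixel (i, j) is (i, i+1) x (j, j+1). *)
Definition pixel (T : 'I_M * 'I_N) : set (R * R) :=
  `](T.1)%:R, (T.1).+1%:R[ `*` `](T.2)%:R, (T.2).+1%:R[.

Definition X u : Prop :=
  L2 Omega u /\ forall T, exists c, forall x, pixel T x -> u x = c.

Definition innerX u v : R := integral_on Omega (fun x => u x * v x).

Definition Y p : Prop := H0div Omega p /\ forall T, RT0 (pixel T) p.

(* Interior edges: inl (i, j) is the vertical edge shared by the pixels (i, j)
   and (i+1, j); inr (i, j) is the horizontal edge shared by (i, j) and
   (i, j+1). *)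
Definition edge : finType := ('I_(M.-1) * 'I_N + 'I_M * 'I_(N.-1))%type.

(* The edge without its endpoints. *)
Definition edge_set (e : edge) : set (R * R) :=
  match e with
  | inl (i, j) => [set i.+1%:R] `*` `]j%:R, j.+1%:R[
  | inr (i, j) => `]i%:R, i.+1%:R[ `*` [set j.+1%:R]
  end.

(* The constant value of the normal component of p in Y on the edge e, read at
   the midpoint of e as the limit along the normal line; the limit is punctured
   and two-sided because p is only given on the open pixels. *)
Definition dof p (e : edge) : R :=
  match e with
  | inl (i, j) => lim ((p (t, j%:R + 2^-1)).1 @[t --> (i.+1%:R : R)^'])
  | inr (i, j) => lim ((p (i%:R + 2^-1, t)).2 @[t --> (j.+1%:R : R)^'])
  end.

Definition innerY p q : R := \sum_(e : edge) dof p e * dof q e.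
Definition normY p : R := Num.sqrt (innerY p p).

Definition psi (e : edge) : field R :=
  get [set p | Y p /\ forall e', dof p e' = (e' == e)%:R].

(* The adjoint of div : Y -> X. *)
Definition div_adj u : field R :=
  get [set r | Y r /\ forall p, Y p -> innerY r p = innerX u (div Omega p)].

Definition J (alpha : R) (f : R * R -> R) p : R :=
  (2 * alpha)^-1 *
  integral_on Omega (fun x => (div Omega p x + alpha * f x) ^+ 2).

End Discretization.

(* K x K array of square subdomains of side d, for M = N = K * d. *)
Section Decomposition.
Context {R : realType} (M N K d : nat).
Implicit Types (p q : field R) (s t : 'I_K * 'I_K).

Definition Omega_sub s : set (R * R) :=
  `](s.1 * d)%:R, ((s.1).+1 * d)%:R[ `*` `](s.2 * d)%:R, ((s.2).+1 * d)%:R[.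

(* Pairs s, t that are adjacent only diagonally contribute a cross point, which
   already lies on the interfaces of the pairs sharing a side. *)
Definition Gamma : set (R * R) :=
  [set x | exists s t,
     s != t /\ (boundary (Omega_sub s) `&` boundary (Omega_sub t)) x].

Definition edge_in_sub s (e : edge M N) : bool :=
  `[< @edge_set R M N e `<=` Omega_sub s >].

Definition edge_on_Gamma (e : edge M N) : bool :=
  `[< @edge_set R M N e `<=` Gamma >].

(* Elements of Y_s are extended by zero outside Omega_s. *)
Definition Y_sub s p : Prop :=
  [/\ H0div (Omega_sub s) p,
      forall T : 'I_M * 'I_N, pixel T `<=` Omega_sub s -> RT0 (pixel T) p &
      forall x, ~ Omega_sub s x -> p x = 0].

Definition C_sub s p : Prop :=
  Y_sub s p /\ forall e, edge_in_sub s e -> `|dof p e| <= 1.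

Definition Y_I : set (field R) :=
  [set p | exists2 ps : 'I_K * 'I_K -> field R,
     forall s, Y_sub s (ps s) & p = (fun x => \sum_s ps s x)].

Definition C_I : set (field R) :=
  [set p | exists2 ps : 'I_K * 'I_K -> field R,
     forall s, C_sub s (ps s) & p = (fun x => \sum_s ps s x)].

Definition combine_Gamma (c : edge M N -> R) : field R :=
  fun x => \sum_(e | edge_on_Gamma e) (c e *: psi e x).

Definition Y_Gamma : set (field R) := range combine_Gamma.

(* The Y_Gamma-component of p in Y. *)
Definition restr_Gamma p : field R := combine_Gamma (dof p).

(* pI is a value of H_I pG. *)
Definition is_H_I (alpha : R) (f : R * R -> R) (pG pI : field R) : Prop :=
  let F q := ((J M N alpha f (fun x => q x + pG x)%R)%:E + chi C_I q)%E in
  Y_I pI /\ forall q, Y_I q -> (F pI <= F q)%E.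

Definition J_Gamma (alpha : R) (f : R * R -> R) (H_I : field R -> field R)
    (pG : field R) : R :=
  J M N alpha f (fun x => H_I pG x + pG x).

(* F : Y_Gamma -> R is (Frechet) differentiable at p with gradient g, for the
   Euclidean structure of Y_Gamma. *)
Definition has_gradient (F : field R -> R) (p g : field R) : Prop :=
  Y_Gamma g /\
  forall eps : R, 0 < eps -> exists2 delta : R, 0 < delta &
    forall h, Y_Gamma h -> normY M N h <= delta ->
      `|F (fun x => p x + h x) - F p - innerY M N g h| <= eps * normY M N h.

Definition grad_J_Gamma (alpha : R) (f : R * R -> R)
    (H_I : field R -> field R) (pG : field R) : field R :=
  restr_Gamma (fun x => alpha^-1 *:
    div_adj M N (fun y => div (Omega M N) (fun z => H_I pG z + pG z) y
                          + alpha * f y) x).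

End Decomposition.

(* Main.v *)
From HB Require Import structures.
Require Import Defs.
From mathcomp Require Import all_boot all_order all_algebra.
From mathcomp Require Import all_classical all_reals all_analysis.
From mathcomp Require Import measurable_realfun.
From mathcomp Require Import ring lra zify.

Set Implicit Arguments.
Unset Strict Implicit.
Unset Printing Implicit Defensive.

Import Order.TTheory GRing.Theory Num.Theory.
Import numFieldNormedType.Exports.

Local Open Scope classical_set_scope.
Local Open Scope ring_scope.

(** The functional J_Gamma is the minimum over the convex set C_I of a convex
quadratic function of the divergence, and it is differentiated as any such
marginal function, by comparing the minimizers at two points.

Once p + p_Gamma is replaced by its residual D = div (p + p_Gamma) + alpha f,
the functional is the squared norm of D divided by 2 alpha.  Let D_p, D_q be
the residuals of the minimizers a, b at p_Gamma, q_Gamma, and let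
H = div (q_Gamma - p_Gamma).  The first-order conditions at a and b, tested
against each other, give <D_p, div (b - a)> >= 0 >= <D_q, div (b - a)>.  Since
D_q - D_p = div (b - a) + H, it follows that |D_q - D_p|^2 <= <D_q - D_p, H>,
whence |D_q - D_p| <= |H| ([perturbation_le]).  Using a as a competitor
at q_Gamma, and b at p_Gamma, then shows that
J_Gamma q_Gamma - J_Gamma p_Gamma - <D_p, H> / alpha is at most |H|^2 / (2 alpha)
in absolute value ([J_Gamma_estimate]); this is differentiability, with the
gradient div^* D_p / alpha restricted to Y_Gamma.

The Lipschitz constant is the square of the norm of div on Y_Gamma divided by
alpha: one factor bounds H by the increment, the other bounds the adjoint.
That norm is at most 2 ([dofdiv_bound]): as the subdomains are at least two
pixels wide, a pixel has at most one vertical and one horizontal edge on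
Gamma, so the square of its divergence is at most twice the sum of two squares,
and each edge belongs to two pixels.

These arguments take place in finite dimension.  The passage from weak
divergences and normal traces in the plane to unknowns on the edges rests on
two facts.  A weak divergence of a field which is RT0 on each pixel is almost
everywhere the constant elementwise divergence ([weak_div_pix]), by the
fundamental lemma of the calculus of variations ([fundamental_lemma]) and
Green's formula.  And such a field lies in H0(div) exactly when its normal
components agree on both sides of the interior edges and vanish on the
boundary edges ([H0div_traced], [traced_H0div]): the fluxes across the edges
can be separated by bump functions, and conversely they telescope. *)


(** * Continuously differentiable test functions *)
Section TestFunctions.
Context {R : realType}.

Lemma continuous_mul (T : topologicalType) (f g : T -> R) :
  continuous f -> continuous g -> continuous (fun x => f x * g x).
Proof. by move=> cf cg x; apply: continuousM; [exact: cf|exact: cg]. Qed.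

Lemma continuous_add (T : topologicalType) (f g : T -> R) :
  continuous f -> continuous g -> continuous (fun x => f x + g x).
Proof. by move=> cf cg x; apply: continuousD; [exact: cf|exact: cg]. Qed.

Lemma continuous_comp_fun (T U : topologicalType) (f : T -> U) (g : U -> R) :
  continuous f -> continuous g -> continuous (fun x => g (f x)).
Proof. by move=> cf cg x; have := continuous_comp (cf x) (cg (f x)). Qed.

Implicit Types (phi psi : R * R -> R).

Lemma C1_differentiable phi x : C1 phi -> differentiable phi x.
Proof. by case. Qed.

Lemma C1_continuous phi : C1 phi -> continuous phi.
Proof. by case=> dphi _ _ x; apply: differentiable_continuous. Qed.

Lemma C1_derivable phi x v : C1 phi -> derivable phi x v.
Proof. by case=> dphi _ _; apply: diff_derivable. Qed.

Lemma C1_M phi psi : C1 phi -> C1 psi -> C1 (fun x => phi x * psi x).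
Proof.
move=> cphi cpsi.
have D v x : 'D_v (fun x => phi x * psi x) x
    = phi x * 'D_v psi x + psi x * 'D_v phi x.
  by rewrite deriveM//; exact: C1_derivable.
split.
- by move=> x; apply: differentiableM; apply: C1_differentiable.
- under eq_fun do rewrite D.
  case: (cphi) (cpsi) => _ p1 p2 [_ q1 q2].
  have [cp cq] := (C1_continuous cphi, C1_continuous cpsi).
  exact: (continuous_add (continuous_mul cp q1) (continuous_mul cq p1)).
- under eq_fun do rewrite D.
  case: (cphi) (cpsi) => _ p1 p2 [_ q1 q2].
  have [cp cq] := (C1_continuous cphi, C1_continuous cpsi).
  exact: (continuous_add (continuous_mul cp q2) (continuous_mul cq p2)).
Qed.

Lemma C1_V phi : C1 phi -> (forall x, 0 < phi x) -> C1 (fun x => (phi x)^-1).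
Proof.
move=> cphi phi0; have phiN0 x : phi x != 0 by rewrite gt_eqF.
have D v x : 'D_v (fun x => (phi x)^-1) x = - (phi x) ^- 2 * 'D_v phi x.
  by rewrite deriveV//; apply: C1_derivable.
have c v : continuous (fun x => 'D_v phi x) ->
    continuous (fun x => 'D_v (fun x => (phi x)^-1) x).
  move=> cD; under eq_fun do rewrite D.
  apply: continuous_mul => // x.
  have c2 : {for x, continuous (fun y => phi y ^+ 2)}.
    by apply: (continuous_mul (C1_continuous cphi) (C1_continuous cphi)).
  have : {for x, continuous (fun y => (phi y ^+ 2)^-1)}.
    by apply: (continuousV _ c2); rewrite expf_neq0.
  exact: continuousN.
split.
- by move=> x; apply: differentiableV => //; apply: C1_differentiable.
- by apply: c; case: cphi.
- by apply: c; case: cphi.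
Qed.

Lemma C1_cst (c : R) : C1 (fun=> c).
Proof.
have D v (x : R * R) : 'D_v (fun=> c) x = 0 by rewrite derive_cst.
split=> [x||]; first exact: differentiable_cst.
- by under eq_fun do rewrite D; move=> x; apply: cvg_cst.
- by under eq_fun do rewrite D; move=> x; apply: cvg_cst.
Qed.

Lemma C1_D phi psi : C1 phi -> C1 psi -> C1 (fun x => phi x + psi x).
Proof.
move=> cphi cpsi.
have D v x : 'D_v (fun x => phi x + psi x) x = 'D_v phi x + 'D_v psi x.
  by rewrite deriveD//; exact: C1_derivable.
split.
- by move=> x; apply: differentiableD; apply: C1_differentiable.
- under eq_fun do rewrite D.
  by case: (cphi) (cpsi) => _ p1 p2 [_ q1 q2]; exact: (continuous_add p1 q1).
- under eq_fun do rewrite D.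
  by case: (cphi) (cpsi) => _ p1 p2 [_ q1 q2]; exact: (continuous_add p2 q2).
Qed.

Let is_diff_fst (x : R * R) : is_diff x (fst : R * R -> R) fst.
Proof.
have lin : linear (fst : R * R -> R) by [].
pose f : {linear (R * R)%type -> R} := HB.pack (fst : R * R -> R) (GRing.isLinear.Build R (R * R)%type R *:%R (fst : R * R -> R) lin).
have cf : continuous f by move=> y; apply: cvg_fst.
by apply: DiffDef; [apply: (linear_differentiable x cf)|rewrite (diff_lin x cf)].
Qed.

Let is_diff_snd (x : R * R) : is_diff x (snd : R * R -> R) snd.
Proof.
have lin : linear (snd : R * R -> R) by [].
pose f : {linear (R * R)%type -> R} := HB.pack (snd : R * R -> R) (GRing.isLinear.Build R (R * R)%type R *:%R (snd : R * R -> R) lin).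
have cf : continuous f by move=> y; apply: cvg_snd.
by apply: DiffDef; [apply: (linear_differentiable x cf)|rewrite (diff_lin x cf)].
Qed.

Section OneVariable.
Variables (k k' : R -> R).
Hypotheses (dk : forall t : R, is_derive t (1 : R) k (k' t)) (ck' : continuous k').

Let dk_diff (t : R) : differentiable k t.
Proof. by apply/derivable1_diffP; have [] := dk t. Qed.

Let k_diff (t s : R) : 'd k t s = s * k' t.
Proof.
rewrite -[in LHS](mulr1 s) -[s * 1]/(s *: (1 : R)) linearZ /= -deriveE//.
by have [_ ->] := dk t.
Qed.

Lemma derive_fst_comp (v x : R * R) : 'D_v (fun x : R * R => k x.1) x = v.1 * k' x.1.
Proof.
have d : is_diff x (k \o fst) ('d k (x.1) \o fst).
  exact: (is_diff_comp (is_diff_fst x) (differentiableP (dk_diff _))).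
rewrite -[fun y : R * R => _]/(k \o fst) deriveE//.
have -> : 'd (k \o fst) x = 'd k (x.1) \o fst :> (R * R -> R) by exact: diff_val.
  by rewrite /= k_diff.
Qed.

Lemma derive_snd_comp (v x : R * R) : 'D_v (fun x : R * R => k x.2) x = v.2 * k' x.2.
Proof.
have d : is_diff x (k \o snd) ('d k (x.2) \o snd).
  exact: (is_diff_comp (is_diff_snd x) (differentiableP (dk_diff _))).
rewrite -[fun y : R * R => _]/(k \o snd) deriveE//.
have -> : 'd (k \o snd) x = 'd k (x.2) \o snd :> (R * R -> R) by exact: diff_val.
  by rewrite /= k_diff.
Qed.

Lemma C1_fst_comp : C1 (fun x => k x.1).
Proof.
have c (v : R * R) : continuous (fun x => 'D_v (fun x : R * R => k x.1) x).
  under eq_fun do rewrite derive_fst_comp.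
  apply: continuous_mul => x; first exact: cvg_cst.
  by apply: continuous_comp; [apply: cvg_fst|apply: ck'].
split; last 2 first.
- exact: c.
- exact: c.
by move=> x; have [] := is_diff_comp (is_diff_fst x) (differentiableP (dk_diff x.1)).
Qed.

Lemma C1_snd_comp : C1 (fun x => k x.2).
Proof.
have c (v : R * R) : continuous (fun x => 'D_v (fun x : R * R => k x.2) x).
  under eq_fun do rewrite derive_snd_comp.
  apply: continuous_mul => x; first exact: cvg_cst.
  by apply: continuous_comp; [apply: cvg_snd|apply: ck'].
split; last 2 first.
- exact: c.
- exact: c.
by move=> x; have [] := is_diff_comp (is_diff_snd x) (differentiableP (dk_diff x.2)).
Qed.

End OneVariable.

(** Squaring the positive part makes it C1 at 0, so that products of such functions
are C1 bumps with an explicit support. *)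
Definition sqpos (t : R) : R := (Num.max 0 t) ^+ 2.

Lemma sqpos_ge0 t : 0 <= sqpos t. Proof. exact: sqr_ge0. Qed.

Lemma sqpos_eq0 t : t <= 0 -> sqpos t = 0.
Proof. by move=> t0; rewrite /sqpos max_l// expr0n. Qed.

Lemma sqposE t : 0 <= t -> sqpos t = t ^+ 2.
Proof. by move=> t0; rewrite /sqpos max_r. Qed.

Lemma sqpos_gt0 t : 0 < t -> 0 < sqpos t.
Proof. by move=> t0; rewrite sqposE ?exprn_gt0// ltW. Qed.

Lemma continuous_max0 : continuous (fun t : R => Num.max 0 t).
Proof. by move=> t; apply: continuous_max; [exact: cvg_cst|exact: cvg_id]. Qed.

Lemma sqpos_continuous : continuous sqpos.
Proof. by apply: continuous_mul; exact: continuous_max0. Qed.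

Lemma sqpos_derive (t : R) : is_derive t (1 : R) sqpos (2 * Num.max 0 t).
Proof.
have [t0|t0|->] := ltgtP t 0.
- rewrite mulr0.
  apply: (@near_eq_is_derive _ _ _ (cst (0 : R))).
    by near=> s; rewrite sqpos_eq0//; apply/ltW; near: s; exact: lt_nbhsl.
- apply: (@near_eq_is_derive _ _ _ ((id : R -> R) * (id : R -> R))).
    by near=> s; rewrite sqposE//; apply/ltW; near: s; exact: lt_nbhsr.
  apply: (@is_derive_eq _ _ _ _ _ _ _ (t *: (1 : R) + t *: (1 : R))).
  by rewrite [t *: _]mulr1 mulr_natl.
- rewrite mulr0.
  have h : (fun h => h^-1 *: ((sqpos \o shift 0) (h *: (1:R)) - sqpos 0))
     @ (0:R)^' --> (0 : R).
    apply: (@cvg_trans _ ((fun h : R => Num.max 0 h) @ (0:R)^')).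
      apply: near_eq_cvg; near=> h.
      have h0 : h != 0 by near: h; exact: nbhs_dnbhs_neq.
      rewrite /= addr0 [h *: 1]mulr1 (@sqpos_eq0 0)// subr0 /sqpos.
      have [hp|hn] := leP 0 h.
        by rewrite expr2 /GRing.scale/= mulKf.
      by rewrite expr0n scaler0.
    have := @continuous_max0 0; rewrite /continuous_at maxxx.
    by move=> c; apply: cvg_within_filter; exact: c.
  apply: DeriveDef; first by apply/cvg_ex; exists 0; exact: h.
  exact: cvg_lim h.
Unshelve. all: by end_near. Qed.

Lemma continuous_dsqpos : continuous (fun t : R => 2 * Num.max 0 t).
Proof. by apply: continuous_mul; [exact: cst_continuous|exact: continuous_max0]. Qed.

Definition bump (a b c d : R) (x : R * R) : R :=
  sqpos (x.1 - a) * sqpos (b - x.1) * (sqpos (x.2 - c) * sqpos (d - x.2)).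

Lemma is_derive_sqpos_subr (a t : R) :
  is_derive t (1 : R) (fun s => sqpos (s - a)) (2 * Num.max 0 (t - a)).
Proof.
have := @is_derive1_comp _ sqpos (fun s => s - a) t _ 1 (sqpos_derive (t - a)).
rewrite mulr1; apply.
have : is_derive t (1 : R) (fun s => s - a) (1 - 0) by apply: is_deriveB.
by rewrite subr0.
Qed.

Lemma is_derive_sqpos_subl (a t : R) :
  is_derive t (1 : R) (fun s => sqpos (a - s)) (- (2 * Num.max 0 (a - t))).
Proof.
have := @is_derive1_comp _ sqpos (fun s => a - s) t _ (-1) (sqpos_derive (a - t)).
rewrite mulrN1; apply.
have : is_derive t (1 : R) (fun s => a - s) (0 - 1) by apply: is_deriveB.
by rewrite sub0r.
Qed.

Lemma bump_C1 a b c d : C1 (bump a b c d).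
Proof.
have cr (z : R) : continuous (fun t => 2 * Num.max 0 (t - z) : R).
  have cm : continuous (fun t : R => t - z).
    by apply: (@continuous_add R id (fun=> - z)) => t; [exact: cvg_id|exact: cvg_cst].
  exact: (continuous_comp_fun cm continuous_dsqpos).
have cl (z : R) : continuous (fun t => - (2 * Num.max 0 (z - t)) : R).
  have cm : continuous (fun t : R => z - t).
    apply: (@continuous_add R (fun=> z) (fun t => - t)) => t; first exact: cvg_cst.
    exact: opp_continuous.
  have c2 : continuous (fun t : R => 2 * Num.max 0 (z - t)).
    exact: (continuous_comp_fun cm continuous_dsqpos).
  have -> : (fun t => - (2 * Num.max 0 (z - t))) = (fun t => -1 * (2 * Num.max 0 (z - t))).
    by apply/funext => t; rewrite mulN1r.
  by apply: continuous_mul => // t; exact: cvg_cst.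
apply: C1_M; apply: C1_M.
- exact: (C1_fst_comp (is_derive_sqpos_subr a) (cr a)).
- exact: (C1_fst_comp (is_derive_sqpos_subl b) (cl b)).
- exact: (C1_snd_comp (is_derive_sqpos_subr c) (cr c)).
- exact: (C1_snd_comp (is_derive_sqpos_subl d) (cl d)).
Qed.

Lemma bump_ge0 a b c d x : 0 <= bump a b c d x.
Proof. by apply: mulr_ge0; apply: mulr_ge0; exact: sqpos_ge0. Qed.

Lemma bump_gt0 a b c d x : a < x.1 -> x.1 < b -> c < x.2 -> x.2 < d ->
  0 < bump a b c d x.
Proof.
by move=> ? ? ? ?; apply: mulr_gt0; apply: mulr_gt0; apply: sqpos_gt0; rewrite subr_gt0.
Qed.

Lemma bump_eq0 a b c d x :
  ~ [/\ a < x.1, x.1 < b, c < x.2 & x.2 < d] -> bump a b c d x = 0.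
Proof.
move=> h; rewrite /bump.
have [xa|xa] := leP x.1 a; first by rewrite (@sqpos_eq0 (x.1 - a)) ?subr_le0 ?mul0r.
have [xb|xb] := leP b x.1; first by rewrite (@sqpos_eq0 (b - x.1)) ?subr_le0 ?mulr0 ?mul0r.
have [xc|xc] := leP x.2 c; first by rewrite (@sqpos_eq0 (x.2 - c)) ?subr_le0 ?mul0r ?mulr0.
have [xd|xd] := leP d x.2; first by rewrite (@sqpos_eq0 (d - x.2)) ?subr_le0 ?mulr0.
by exfalso; apply: h.
Qed.

End TestFunctions.

(** * Lebesgue measure on the plane *)
(** The plane carries two convertible measurable structures, one for each of those on
R.  The notations and the definition below fix the one on which [lebesgue_measure] is
defined. *)
Notation mplane R A := (@measurable _ (measurableTypeR R * measurableTypeR R)%type A).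
Notation mfun R D f := (@measurable_fun _ _ (measurableTypeR R * measurableTypeR R)%type R D f).
Notation mefun R D f := (@measurable_fun _ _ (measurableTypeR R * measurableTypeR R)%type (\bar R) D f).

Definition mu2 {R : realType} : {measure set (measurableTypeR R * measurableTypeR R) -> \bar R} :=
  (@lebesgue_measure R \x @lebesgue_measure R)%E.

Section Plane.
Context {R : realType}.
Notation mu := (@lebesgue_measure R).
Notation mu2 := (@mu2 R).
Implicit Types (a b c d : R).

Definition box a b c d : set (R * R) := `]a, b[ `*` `]c, d[.

Lemma boxP a b c d (x : R * R) :
  box a b c d x <-> [/\ a < x.1, x.1 < b, c < x.2 & x.2 < d].
Proof.
rewrite /box/= !in_itv/=; split; first by move=> [/andP[? ?] /andP[? ?]].
by move=> [-> -> -> ->].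
Qed.

Lemma measurable_box a b c d : mplane R (box a b c d).
Proof. by apply: measurableX; exact: measurable_itv. Qed.

Lemma open_box a b c d : open (box a b c d).
Proof.
rewrite (_ : box a b c d = fst @^-1` `]a, b[ `&` snd @^-1` `]c, d[)//.
apply: openI; apply: open_comp => //; try exact: interval_open.
- by move=> x _; apply: cvg_fst.
- by move=> x _; apply: cvg_snd.
Qed.

Lemma integral_onE (D : set (R * R)) (u : R * R -> R) :
  integral_on D u = \int[mu2]_(x in D) u x.
Proof. by []. Qed.

Lemma L2P (D : set (R * R)) (u : R * R -> R) :
  L2 D u <-> mfun R D u /\ (\int[mu2]_(x in D) ((u x ^+ 2)%:E) < +oo)%E.
Proof. by []. Qed.

Lemma rat_between (x y : R) : x < y -> exists q : rat, x < ratr q /\ ratr q < y.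
Proof.
move=> xy; have [q] := rat_in_itvoo xy.
by rewrite in_itv/= => /andP[? ?]; exists q.
Qed.

(** An open set is the union of the countably many rational boxes inside it. *)
Lemma open_measurable_plane (U : set (R * R)) : open U -> mplane R U.
Proof.
move=> oU.
pose F (q1 q2 q3 q4 : rat) : set (R * R) :=
  if `[< box (ratr q1) (ratr q2) (ratr q3) (ratr q4) `<=` U >]
  then box (ratr q1) (ratr q2) (ratr q3) (ratr q4) else set0.
have -> : U = \bigcup_q1 \bigcup_q2 \bigcup_q3 \bigcup_q4 F q1 q2 q3 q4.
  apply/seteqP; split=> [x Ux|x [q1 _ [q2 _ [q3 _ [q4 _]]]]]; last first.
    by rewrite /F; case: asboolP => // h /h.
  have [e /= e0 xeU] : exists2 e : R, 0 < e & ball x e `<=` U.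
    by apply/nbhs_ballP; move: oU; rewrite openE; exact.
  have [q1 [a1 a2]] : exists q : rat, (x.1 - e) < ratr q /\ ratr q < x.1.
    by apply: rat_between; rewrite ltrBlDr ltrDl.
  have [q2 [b1 b2]] : exists q : rat, x.1 < ratr q /\ ratr q < (x.1 + e).
    by apply: rat_between; rewrite ltrDl.
  have [q3 [c1 c2]] : exists q : rat, (x.2 - e) < ratr q /\ ratr q < x.2.
    by apply: rat_between; rewrite ltrBlDr ltrDl.
  have [q4 [d1 d2]] : exists q : rat, x.2 < ratr q /\ ratr q < (x.2 + e).
    by apply: rat_between; rewrite ltrDl.
  exists q1 => //; exists q2 => //; exists q3 => //; exists q4 => //.
  rewrite /F; case: asboolP; first by move=> _; apply/boxP.
  case=> y /boxP[? ? ? ?]; apply: xeU; split; rewrite /ball/= ltr_distlC.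
    by apply/andP; split; lra.
  by apply/andP; split; lra.
apply: bigcupT_measurable_rat => q1; apply: bigcupT_measurable_rat => q2.
apply: bigcupT_measurable_rat => q3; apply: bigcupT_measurable_rat => q4.
by rewrite /F; case: ifP => _ //; exact: measurable_box.
Qed.

Lemma continuous_measurable_plane (f : R * R -> R) (D : set (R * R)) :
  mplane R D -> continuous f -> mfun R D f.
Proof.
move=> mD /continuousP cf.
apply: measurable_funS (measurableT) (@subsetT _ _) _.
apply: (measurability _ (RGenOpens.measurableE R)).
move=> _ [_ [a [b ->] <-]]; rewrite setTI; apply: open_measurable_plane.
exact/cf/interval_open.
Qed.

Lemma mu2X (A B : set R) : measurable (A : set (measurableTypeR R)) -> measurable (B : set (measurableTypeR R)) ->
  mu2 (A `*` B) = (mu A * mu B)%E.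
Proof. by move=> mA mB; rewrite /= product_measure1E. Qed.

Lemma box_lty a b c d : (mu2 (box a b c d) < +oo)%E.
Proof.
rewrite mu2X//; apply: lte_mul_pinfty => //.
- by rewrite lebesgue_measure_itv; case: ifP => // _; rewrite -EFinD.
- by rewrite lebesgue_measure_itv; case: ifP => // _; rewrite -EFinD ltry.
Qed.

Lemma vline_null a (B : set R) : measurable (B : set (measurableTypeR R)) -> mu2 ([set a] `*` B) = 0%E.
Proof. by move=> mB; rewrite mu2X// lebesgue_measure_set1 mul0e. Qed.

Lemma hline_null a (B : set R) : measurable (B : set (measurableTypeR R)) -> mu2 (B `*` [set a]) = 0%E.
Proof. by move=> mB; rewrite mu2X// lebesgue_measure_set1 mule0. Qed.

(** For cutting a box in two along a line N. *)
Lemma integral_setU_null (A B N : set (R * R)) (f : R * R -> \bar R) :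
  mplane R A -> mplane R B -> mplane R N -> mu2 N = 0%E ->
  [disjoint A & B] -> [disjoint A `|` B & N] ->
  mefun R (A `|` B `|` N) f ->
  (\int[mu2]_(x in A `|` B `|` N) f x =
   \int[mu2]_(x in A) f x + \int[mu2]_(x in B) f x)%E.
Proof.
move=> mA mB mN N0 AB ABN mf.
have mAB : mplane R (A `|` B) by exact: measurableU.
rewrite (integral_setU _ mAB mN mf ABN) (integral_setU _ mA mB _ AB).
  have mfN : mefun R N f.
    by apply: measurable_funS mf => //; exact: measurableU.
  by rewrite (null_set_integral mN mfN N0) adde0.
by apply: measurable_funS mf => //; exact: measurableU.
Qed.

Lemma integral_box_vcut a m b c d (f : R * R -> \bar R) : a <= m -> m <= b ->
  mefun R (box a b c d) f ->
  (\int[mu2]_(x in box a b c d) f x =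
   \int[mu2]_(x in box a m c d) f x + \int[mu2]_(x in box m b c d) f x)%E.
Proof.
rewrite le_eqVlt => /predU1P[<- ab _|am].
  by rewrite [X in (_ = X + _)%E](_ : _ = 0%E) ?add0e// /box set_itv_ge ?bnd_simp ?ltxx// set0X integral_set0.
rewrite le_eqVlt => /predU1P[-> mf|mb].
  by rewrite [X in (_ = _ + X)%E](_ : _ = 0%E) ?adde0// /box set_itv_ge ?bnd_simp ?ltxx// set0X integral_set0.
have E : box a b c d = box a m c d `|` box m b c d `|` [set m] `*` `]c, d[.
  apply/seteqP; split=> x.
    move=> /boxP[? ? ? ?].
    have [xm|xm|xm] := ltgtP x.1 m; [left;left|left;right|right].
    - exact/boxP.
    - exact/boxP.
    - by split => //=; rewrite in_itv/=; apply/andP.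
  case=> [[|]/boxP[? ? ? ?]|[/= xm]]; try by apply/boxP; split => //; lra.
  by rewrite in_itv/= => /andP[? ?]; apply/boxP; split => //; rewrite xm.
rewrite E => mf; apply: integral_setU_null mf; try exact: measurable_box.
- exact: measurableX.
- exact: vline_null.
- apply/disj_setPS => x [/boxP[? ? ? ?] /boxP[? ? ? ?]]; lra.
- by apply/disj_setPS => x [[|]/boxP[? ? ? ?] [/= ? _]]; lra.
Qed.

Lemma integral_box_hcut a b c m d (f : R * R -> \bar R) : c <= m -> m <= d ->
  mefun R (box a b c d) f ->
  (\int[mu2]_(x in box a b c d) f x =
   \int[mu2]_(x in box a b c m) f x + \int[mu2]_(x in box a b m d) f x)%E.
Proof.
rewrite le_eqVlt => /predU1P[<- ab _|am].
  by rewrite [X in (_ = X + _)%E](_ : _ = 0%E) ?add0e// /box (@set_itv_ge _ _ (BRight c)) ?bnd_simp ?ltxx// setX0 integral_set0.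
rewrite le_eqVlt => /predU1P[-> mf|mb].
  by rewrite [X in (_ = _ + X)%E](_ : _ = 0%E) ?adde0// /box (@set_itv_ge _ _ (BRight d)) ?bnd_simp ?ltxx// setX0 integral_set0.
have E : box a b c d = box a b c m `|` box a b m d `|` `]a, b[ `*` [set m].
  apply/seteqP; split=> x.
    move=> /boxP[? ? ? ?].
    have [xm|xm|xm] := ltgtP x.2 m; [left;left|left;right|right].
    - exact/boxP.
    - exact/boxP.
    - by split => //=; rewrite in_itv/=; apply/andP.
  case=> [[|]/boxP[? ? ? ?]|[/=]]; try by apply/boxP; split => //; lra.
  by rewrite in_itv/= => /andP[? ?] xm; apply/boxP; split => //; rewrite xm.
rewrite E => mf; apply: integral_setU_null mf; try exact: measurable_box.
- exact: measurableX.
- exact: hline_null.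
- by apply/disj_setPS => x [/boxP[? ? ? ?] /boxP[? ? ? ?]]; lra.
- by apply/disj_setPS => x [[|]/boxP[? ? ? ?] [/= _ ?]]; lra.
Qed.

End Plane.

(** * The fundamental lemma of the calculus of variations *)
Section FundamentalLemma.
Context {R : realType}.
Notation mu2 := (@mu2 R).
Notation mT := (measurableTypeR R).

(** The sets A with vanishing integral over D and h @^-1 A form a Dynkin system.
Taking for h the two projections and then the identity leads from quadrants to
products and to all measurable sets. *)
Lemma integral0_preimage (d : measure_display) (T : measurableType d)
    (h : mT * mT -> T) (G : set (set T)) (D : set (R * R)) (w : R * R -> \bar R) :
  measurable_fun setT h -> measurable = <<s G >> -> setI_closed G ->
  mplane R D -> mu2.-integrable D w ->
  (\int[mu2]_(x in D) w x = 0)%E ->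
  (forall A, G A -> \int[mu2]_(x in D `&` h @^-1` A) w x = 0)%E ->
  forall A, measurable A -> (\int[mu2]_(x in D `&` h @^-1` A) w x = 0)%E.
Proof.
move=> mh mG GI mD iw w0 wG A mA.
have mp B : measurable B -> mplane R (D `&` h @^-1` B).
  by move=> mB; apply: measurableI => //; rewrite -[_ @^-1` _]setTI; exact: mh.
have mw : mefun R D w by exact: measurable_int iw.
apply: (@dynkin_induction _ T G (fun A => (\int[mu2]_(x in D `&` h @^-1` A) w x = 0)%E)) => //.
- by rewrite preimage_setT setIT.
- move=> S mS wS.
  have E : D = (D `&` h @^-1` S) `|` (D `&` h @^-1` (~` S)).
    by rewrite -setIUr preimage_setC setUv setIT.
  move: w0; rewrite {1}E integral_setU; last 4 first.
  - exact: mp.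
  - by apply: mp; exact: measurableC.
  - by rewrite -E.
  - by apply/disj_setPS => x [[_ ?] [_ ?]].
  by rewrite wS add0e.
- move=> F mF tF wF.
  rewrite preimage_bigcup setI_bigcupr integral_bigcup.
  + by apply: eseries0 => k _ _; exact: wF.
  + apply/trivIsetP => i j _ _ ij; rewrite -subset0 => x [[_ Fi] [_ Fj]].
    have := tF; move/trivIsetP/(_ i j I I ij) => E.
    by have : (F i `&` F j) (h x) by []; rewrite E.
  + by move=> k; exact: mp.
  + apply: integrableS iw => //; first by apply: bigcup_measurable => k _; exact: mp.
    by move=> x [k _ []].
- by rewrite -mG.
Qed.

Lemma measurable_fst_plane : measurable_fun (setT : set (mT * mT)) (fst : mT * mT -> mT).
Proof. exact: measurable_fst. Qed.

Lemma measurable_snd_plane : measurable_fun (setT : set (mT * mT)) (snd : mT * mT -> mT).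
Proof. exact: measurable_snd. Qed.

Let rayI : setI_closed (@RGenOInfty.G R).
Proof.
move=> _ _ [x ->] [y ->]; exists (Num.max x y).
apply/seteqP; split => z; rewrite /= !in_itv/= !andbT gt_max; last by move/andP.
by move=> [-> ->].
Qed.

(** Intersecting a box with quadrants gives boxes, and quadrants generate the
measurable sets of the plane. *)
Lemma integral0_box_ae (a b c d : R) (w : R * R -> R) :
  mu2.-integrable (box a b c d) (EFin \o w) ->
  (forall a' b' c' d', a <= a' -> b' <= b -> c <= c' -> d' <= d ->
    (\int[mu2]_(x in box a' b' c' d') (w x)%:E = 0)%E) ->
  ae_eq mu2 (box a b c d) (EFin \o w) (cst 0%E).
Proof.
move=> iw w0; set D := box a b c d.
have mD : mplane R D by exact: measurable_box.
have mray := RGenOInfty.measurableE R.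
have wQ x y : (\int[mu2]_(z in D `&` fst @^-1` `]x, +oo[ `&` snd @^-1` `]y, +oo[) (w z)%:E = 0)%E.
  rewrite (_ : _ `&` _ = box (Num.max a x) b (Num.max c y) d).
    by apply: w0; rewrite ?le_max ?lexx.
  apply/seteqP; split=> z.
    case=> [[/boxP[? ? ? ?]]]/=; rewrite !in_itv/= !andbT => ? ?.
    by apply/boxP; split=> //; rewrite gt_max; apply/andP.
  move=> /boxP[]; rewrite !gt_max => /andP[? ?] ? /andP[? ?] ?.
  by split; [split; [exact/boxP|]|]; rewrite /= in_itv/= andbT.
have DI (A : set mT) : measurable A -> mplane R (D `&` fst @^-1` A).
  move=> mA; apply: measurableI => //; rewrite -[_ @^-1` _]setTI.
  exact: measurable_fst_plane.
have iwD E : mplane R E -> E `<=` D -> mu2.-integrable E (EFin \o w).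
  by move=> mE ED; exact: integrableS iw.
have w1 (A : set mT) y : measurable A ->
    (\int[mu2]_(z in D `&` fst @^-1` A `&` snd @^-1` `]y, +oo[) (w z)%:E = 0)%E.
  move=> mA; rewrite setIAC; move: A mA.
  have mDy : mplane R (D `&` snd @^-1` `]y, +oo[).
    apply: measurableI => //; rewrite -[_ @^-1` _]setTI.
    by apply: measurable_snd_plane => //; exact: measurable_itv.
  apply: (integral0_preimage measurable_fst_plane mray rayI) => //.
  - by apply: iwD => // z [].
  - have := wQ a y; rewrite (_ : D `&` fst @^-1` _ = D)//.
    apply/seteqP; split=> z; first by case.
    by move=> Dz; split => //; move: Dz => /boxP[]; rewrite /= in_itv/= andbT.
  - by move=> _ [x ->]; rewrite setIAC.
have w2 (A B : set mT) : measurable A -> measurable B ->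
    (\int[mu2]_(z in D `&` fst @^-1` A `&` snd @^-1` B) (w z)%:E = 0)%E.
  move=> mA; move: B.
  apply: (integral0_preimage measurable_snd_plane mray rayI) => //.
  - exact: DI.
  - by apply: iwD; [exact: DI|move=> z []].
  - have := w1 A c mA; rewrite (_ : D `&` fst @^-1` _ `&` _ = D `&` fst @^-1` A)//.
    apply/seteqP; split=> z; first by case.
    by move=> [Dz Az]; split => //; move: Dz => /boxP[]; rewrite /= in_itv/= andbT.
  - by move=> _ [y ->]; exact: w1.
have w3 (E : set (mT * mT)) : measurable E -> (\int[mu2]_(z in D `&` E) (w z)%:E = 0)%E.
  move: E.
  apply: (@integral0_preimage _ (mT * mT)%type id _ _ _ _ (measurable_prod_measurableType mT mT)) => //.
  - move=> _ _ [A1 mA1 [B1 mB1 <-]] [A2 mA2 [B2 mB2 <-]].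
    exists (A1 `&` A2); first exact: measurableI.
    by exists (B1 `&` B2); [exact: measurableI|rewrite setXI].
  - have := @w2 setT setT measurableT measurableT.
    by rewrite !preimage_setT !setIT.
  - move=> _ [A mA [B mB <-]].
    by have := w2 A B mA mB; rewrite -setIA.
apply: integral_ae_eq => //.
move=> E ED mE; rewrite [RHS]integral0.
by have := w3 E mE; rewrite setIidr.
Qed.

Section Test.
Variables (a b c d a' b' c' d' : R).
Hypotheses (aa : a <= a') (bb : b' <= b) (cc : c <= c') (dd : d' <= d).

Let P (e : R) := bump (a' + e) (b' - e) (c' + e) (d' - e).
(* As e tends to 0, P / (e + P) tends to the indicator of the open box.  Shrinking
   that box by e keeps the support compact in box a b c d when sides are shared. *)
Let cutoff (e : R) (x : R * R) : R := P e x / (e + P e x).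

Let cutoff_ge0 e x : 0 < e -> 0 <= cutoff e x <= 1.
Proof.
move=> e0; have P0 : 0 <= P e x by exact: bump_ge0.
have eP : 0 < e + P e x by rewrite ltr_wpDr.
apply/andP; split; first by apply: divr_ge0 => //; exact: ltW.
by rewrite /cutoff ler_pdivrMr// mul1r lerDr ltW.
Qed.

Let cutoff_C1c e : 0 < e -> C1c (box a b c d) (cutoff e).
Proof.
move=> e0; split.
  apply: C1_M; first exact: bump_C1.
  apply: C1_V; first by apply: C1_D; [exact: C1_cst|exact: bump_C1].
  by move=> x; rewrite ltr_wpDr// bump_ge0.
exists (`[a' + e, b' - e] `*` `[c' + e, d' - e]).
  split; first by apply: compact_setX; exact: segment_compact.
  move=> x [] /=; rewrite !in_itv/= => /andP[? ?] /andP[? ?].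
  by apply/boxP; move: aa bb cc dd => *; split; lra.
move=> x nx; rewrite /cutoff /P bump_eq0 ?mul0r// => -[? ? ? ?]; apply: nx.
by split; rewrite /= in_itv/=; apply/andP; split; exact: ltW.
Qed.

Let cutoff_cvg x : cutoff (n.+1%:R^-1) x @[n --> \oo] --> (\1_(box a' b' c' d') x : R).
Proof.
have [/boxP Qx|Qx] := pselect (box a' b' c' d' x); last first.
  rewrite indicE memNset//; apply: cvg_near_cst; apply: nearW => n.
  rewrite /cutoff /P bump_eq0 ?mul0r//.
  have e0 : (0 : R) < n.+1%:R^-1 by [].
  move: (n.+1%:R^-1) e0 => e e0.
  by move=> [? ? ? ?]; apply: Qx; apply/boxP; split; lra.
rewrite indicE mem_set; last exact/boxP.
have cP : P e x @[e --> (0 : R)] --> P 0 x.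
  have s (f : R -> R) l : f e @[e --> (0 : R)] --> l ->
      sqpos (f e) @[e --> (0 : R)] --> sqpos l.
    by move=> fl; apply: continuous_cvg => //; exact: sqpos_continuous.
  have id0 : (fun e : R => e) @ (0 : R) --> (0 : R) by exact: cvg_id.
  have c0 (z : R) : (fun _ : R => z) @ (0 : R) --> z by exact: cvg_cst.
  have s1 : sqpos (x.1 - (a' + e)) @[e --> (0 : R)] --> sqpos (x.1 - (a' + 0)).
    by apply: s; apply: cvgB => //; exact: cvgD.
  have s2 : sqpos (b' - e - x.1) @[e --> (0 : R)] --> sqpos (b' - 0 - x.1).
    by apply: s; apply: cvgB => //; exact: cvgB.
  have s3 : sqpos (x.2 - (c' + e)) @[e --> (0 : R)] --> sqpos (x.2 - (c' + 0)).
    by apply: s; apply: cvgB => //; exact: cvgD.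
  have s4 : sqpos (d' - e - x.2) @[e --> (0 : R)] --> sqpos (d' - 0 - x.2).
    by apply: s; apply: cvgB => //; exact: cvgB.
  exact: (cvgM (cvgM s1 s2) (cvgM s3 s4)).
have P0 : 0 < P 0 x by case: Qx => ? ? ? ?; apply: bump_gt0; rewrite ?addr0 ?subr0.
have c1 : cutoff e x @[e --> (0 : R)] --> (1 : R).
  have -> : (1 : R) = P 0 x / (0 + P 0 x) by rewrite add0r divff ?gt_eqF.
  apply: cvgM => //; apply: cvgV; first by rewrite add0r gt_eqF.
  by apply: cvgD => //; exact: cvg_id.
apply: (cvg_comp _ _ _ c1).
exact: cvg_harmonic.
Qed.

(** By dominated convergence along the cutoffs, with dominating function |w|. *)
Lemma integral_fundamental_box (w : R * R -> R) :
  mu2.-integrable (box a b c d) (EFin \o w) ->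
  (forall phi, C1c (box a b c d) phi ->
    integral_on (box a b c d) (fun x => w x * phi x) = 0) ->
  (\int[mu2]_(x in box a' b' c' d') (w x)%:E = 0)%E.
Proof.
move=> iw w0; set D := box a b c d.
have mD : mplane R D by exact: measurable_box.
have mQ : mplane R (box a' b' c' d') by exact: measurable_box.
have mw : mfun R D w by apply/measurable_EFinP; exact: measurable_int iw.
have e0 n : (0 : R) < n.+1%:R^-1 by [].
have mcut n : mfun R D (cutoff n.+1%:R^-1).
  apply: continuous_measurable_plane => //; apply: C1_continuous.
  by have [] := cutoff_C1c (e0 n).
pose f_ n (x : R * R) : \bar R := (w x * cutoff n.+1%:R^-1 x)%:E.
pose f (x : R * R) : \bar R := (w x * \1_(box a' b' c' d') x)%:E.
have mf_ n : mefun R D (f_ n).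
  by apply/measurable_EFinP; apply: measurable_funM => //; exact: mcut.
have mf : mefun R D f.
  by apply/measurable_EFinP; apply: measurable_funM.
have dom n x : D x -> (`|f_ n x| <= (abse \o (EFin \o w)) x)%E.
  move=> _; rewrite /= lee_fin normrM ler_piMr// ger0_norm;
    by have /andP[] := cutoff_ge0 x (e0 n).
have cf : {ae mu2, forall x, D x -> f_ ^~ x @ \oo --> f x}.
  apply: aeW => x _; apply: cvg_EFin; first exact: nearW.
  apply: cvgM; [exact: cvg_cst|exact: cutoff_cvg].
have aedom : {ae mu2, forall x n, D x -> (`|f_ n x| <= (abse \o (EFin \o w)) x)%E}.
  by apply: aeW => x n; exact: dom.
have [_ _ cvI] := dominated_convergence mD mf_ mf cf (integrable_abse iw) aedom.
have I0 n : (\int[mu2]_(x in D) f_ n x = 0)%E.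
  have fin : (\int[mu2]_(x in D) f_ n x)%E \is a fin_num.
    apply: integrable_fin_num => //; apply: le_integrable iw => //.
    by move=> x Dx; exact: dom.
  by rewrite -(fineK fin); congr EFin; exact: w0 (cutoff_C1c (e0 n)).
have QD : box a' b' c' d' `<=` D.
  by move=> x /boxP[? ? ? ?]; apply/boxP; move: aa bb cc dd => *; split; lra.
have <- : (\int[mu2]_(x in D) f x = \int[mu2]_(x in box a' b' c' d') (w x)%:E)%E.
  transitivity (\int[mu2]_(x in D) ((EFin \o w) \_ (box a' b' c' d')) x)%E.
    apply: eq_integral => x _.
    by rewrite /f patchE indicE; case: ifP => _; rewrite ?mulr1 ?mulr0.
  by rewrite -integral_mkcondr setIidr.
have : (fun n => \int[mu2]_(x in D) f_ n x)%E @ \oo --> (0 : \bar R)%E.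
  by under eq_fun do rewrite I0; exact: cvg_cst.
move=> cv0; apply: (cvg_unique _ cvI cv0).
exact: ereal_hausdorff.
Qed.

End Test.

Lemma fundamental_lemma (a b c d : R) (w : R * R -> R) :
  mu2.-integrable (box a b c d) (EFin \o w) ->
  (forall phi, C1c (box a b c d) phi ->
    integral_on (box a b c d) (fun x => w x * phi x) = 0) ->
  ae_eq mu2 (box a b c d) (EFin \o w) (cst 0%E).
Proof.
move=> iw w0; apply: integral0_box_ae => // a' b' c' d' *.
exact: integral_fundamental_box iw w0.
Qed.

End FundamentalLemma.

(** * Green's formula on a box *)
Section Green.
Context {R : realType}.
Notation mu := (@lebesgue_measure R).
Notation mu2 := (@mu2 R).
Notation mT := (measurableTypeR R).

Lemma continuous_bounded_box (a b c d : R) (f : R * R -> R) : continuous f ->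
  exists C, forall x, box a b c d x -> `|f x| <= C.
Proof.
move=> cf.
have cK : compact (`[a, b] `*` `[c, d]) by apply: compact_setX; exact: segment_compact.
have /compact_bounded : compact (f @` (`[a, b] `*` `[c, d])).
  by apply: continuous_compact => //; exact: continuous_subspaceT.
move=> [M [_ bM]]; exists (M + 1) => x /boxP[? ? ? ?].
apply: (bM (M + 1)); first by rewrite ltrDl.
exists x => //; split; rewrite /= in_itv/=; apply/andP; split; exact: ltW.
Qed.

Lemma bounded_integrable_box (a b c d C : R) (f : R * R -> R) :
  mfun R (box a b c d) f -> (forall x, box a b c d x -> `|f x| <= C) ->
  mu2.-integrable (box a b c d) (EFin \o f).
Proof.
move=> mf fC; apply: measurable_bounded_integrable => //.
- exact: measurable_box.
- exact: box_lty.
- exists C; split; first exact: num_real.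
  by move=> M CM x Dx; apply: le_trans (fC x Dx) _; exact: ltW.
Qed.

Lemma continuous_integrable_box (a b c d : R) (f : R * R -> R) :
  continuous f -> mu2.-integrable (box a b c d) (EFin \o f).
Proof.
move=> cf; have [C fC] := continuous_bounded_box a b c d cf.
apply: bounded_integrable_box fC; apply: continuous_measurable_plane => //.
exact: measurable_box.
Qed.

Lemma C1_slice1 (psi : R * R -> R) (y t : R) : C1 psi ->
  derivable (fun s => psi (s, y)) t 1 /\
  'D_1 (fun s => psi (s, y)) t = 'D_e1 psi (t, y).
Proof.
move=> cpsi; have := @C1_derivable _ _ (t, y) e1 cpsi.
rewrite /derivable /derive.
suff -> : (fun h : R => h^-1 *: ((psi \o shift (t, y)) (h *: e1) - psi (t, y))) =
   (fun h => h^-1 *: (((fun s => psi (s, y)) \o shift t) (h *: (1 : R)) - psi (t, y))) by [].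
apply/funext => h; rewrite /shift /=; congr (_ *: (psi _ - _)).
by apply: injective_projections => //=; rewrite -[LHS]/(h * 0 + y) mulr0 add0r.
Qed.

Lemma C1_slice2 (psi : R * R -> R) (y t : R) : C1 psi ->
  derivable (fun s => psi (y, s)) t 1 /\
  'D_1 (fun s => psi (y, s)) t = 'D_e2 psi (y, t).
Proof.
move=> cpsi; have := @C1_derivable _ _ (y, t) e2 cpsi.
rewrite /derivable /derive.
suff -> : (fun h : R => h^-1 *: ((psi \o shift (y, t)) (h *: e2) - psi (y, t))) =
   (fun h => h^-1 *: (((fun s => psi (y, s)) \o shift t) (h *: (1 : R)) - psi (y, t))) by [].
apply/funext => h; rewrite /shift /=; congr (_ *: (psi _ - _)).
by apply: injective_projections => //=; rewrite -[LHS]/(h * 0 + y) mulr0 add0r.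
Qed.

Lemma continuous_slice1 (psi : R * R -> R) (y : R) : continuous psi ->
  continuous (fun s => psi (s, y)).
Proof.
move=> cpsi; apply: (continuous_comp_fun _ cpsi) => t.
exact: (cvg_pair cvg_id (cvg_cst _)).
Qed.

Lemma continuous_slice2 (psi : R * R -> R) (y : R) : continuous psi ->
  continuous (fun s => psi (y, s)).
Proof.
move=> cpsi; apply: (continuous_comp_fun _ cpsi) => t.
exact: (cvg_pair (cvg_cst _) cvg_id).
Qed.

(** The fundamental theorem of calculus, on an open interval. *)
Lemma integral_derivative (F f : R -> R) (a b : R) : a < b -> continuous f ->
  (forall t : R, derivable F t 1 /\ 'D_1 F t = f t) ->
  (\int[mu]_(x in `]a, b[) (f x)%:E = (F b - F a)%:E)%E.
Proof.
move=> ab cf dF.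
have cF : continuous F.
  by move=> t; apply: differentiable_continuous; apply/derivable1_diffP; exact: (dF t).1.
have mf (A : set R) : measurable (A : set mT) -> measurable_fun (A : set mT) (EFin \o f).
  by move=> mA; apply/measurable_EFinP; apply: measurable_funTS; exact: continuous_measurable_fun.
rewrite integral_itv_obnd_cbnd; last exact: mf.
rewrite integral_itv_bndo_bndc; last exact: mf.
rewrite (@continuous_FTC2 R f F a b)//.
- exact: continuous_subspaceT.
- split; first by move=> t _; exact: (dF t).1.
  + by apply: cvg_at_right_filter; exact: cF.
  + by apply: cvg_at_left_filter; exact: cF.
- by move=> t _; rewrite derive1E (dF t).2.
Qed.

Lemma mem_box (a b c d x y : R) :
  ((x, y) \in box a b c d) = (x \in `]a, b[) && (y \in `]c, d[).
Proof.
apply/idP/idP.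
  by rewrite inE => /boxP[/= *]; rewrite !in_itv/=; apply/and3P; split => //; apply/andP.
by rewrite !in_itv/= => /andP[/andP[? ?] /andP[? ?]]; rewrite inE; apply/boxP.
Qed.

Lemma integral_box_xy (a b c d : R) (f : R * R -> R) :
  mu2.-integrable (box a b c d) (EFin \o f) ->
  (\int[mu2]_(x in box a b c d) (f x)%:E =
   \int[mu]_(y in `]c, d[) \int[mu]_(x in `]a, b[) (f (x, y))%:E)%E.
Proof.
move=> If; have mD : mplane R (box a b c d) by exact: measurable_box.
have If' : mu2.-integrable setT ((EFin \o f) \_ (box a b c d)) by exact: (integrable_mkcond _ mD).1 If.
rewrite integral_mkcond -(integral21_prod_meas1 If') /fubini_G.
rewrite [RHS]integral_mkcond; apply: eq_integral => y _.
rewrite patchE; case: ifPn => yc.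
  rewrite [RHS]integral_mkcond; apply: eq_integral => x _.
  by rewrite !patchE mem_box mem_setE; move: yc; rewrite mem_setE => ->; rewrite andbT.
rewrite -[RHS](integral0 mu setT); apply: eq_integral => x _.
by rewrite patchE mem_box; move: yc; rewrite mem_setE => /negbTE->; rewrite andbF.
Qed.

Lemma integral_box_yx (a b c d : R) (f : R * R -> R) :
  mu2.-integrable (box a b c d) (EFin \o f) ->
  (\int[mu2]_(x in box a b c d) (f x)%:E =
   \int[mu]_(x in `]a, b[) \int[mu]_(y in `]c, d[) (f (x, y))%:E)%E.
Proof.
move=> If; have mD : mplane R (box a b c d) by exact: measurable_box.
have If' : mu2.-integrable setT ((EFin \o f) \_ (box a b c d)) by exact: (integrable_mkcond _ mD).1 If.
rewrite integral_mkcond -(integral12_prod_meas1 If') /fubini_F.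
rewrite [RHS]integral_mkcond; apply: eq_integral => x _.
rewrite patchE; case: ifPn => xc.
  rewrite [RHS]integral_mkcond; apply: eq_integral => y _.
  by rewrite !patchE mem_box mem_setE; move: xc; rewrite mem_setE => ->.
rewrite -[RHS](integral0 mu setT); apply: eq_integral => y _.
by rewrite patchE mem_box; move: xc; rewrite mem_setE => /negbTE->.
Qed.

Lemma green1 (a b c d : R) (psi : R * R -> R) : a < b -> C1 psi ->
  integral_on (box a b c d) ('D_e1 psi) =
  \int[mu]_(y in `]c, d[) (psi (b, y) - psi (a, y)).
Proof.
move=> ab cpsi; rewrite integral_onE /Rintegral; congr fine.
have cD : continuous ('D_e1 psi) by case: cpsi.
rewrite integral_box_xy; last exact: continuous_integrable_box.
apply: eq_integral => y _.
rewrite (@integral_derivative (fun s => psi (s, y)) (fun s => 'D_e1 psi (s, y)))//; first exact: continuous_slice1 cD.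
by move=> t; exact: C1_slice1.
Qed.

Lemma green2 (a b c d : R) (psi : R * R -> R) : c < d -> C1 psi ->
  integral_on (box a b c d) ('D_e2 psi) =
  \int[mu]_(x in `]a, b[) (psi (x, d) - psi (x, c)).
Proof.
move=> ab cpsi; rewrite integral_onE /Rintegral; congr fine.
have cD : continuous ('D_e2 psi) by case: cpsi.
rewrite integral_box_yx; last exact: continuous_integrable_box.
apply: eq_integral => x _.
rewrite (@integral_derivative (fun s => psi (x, s)) (fun s => 'D_e2 psi (x, s)))//; first exact: continuous_slice2 cD.
by move=> t; exact: C1_slice2.
Qed.

Lemma continuous_integrable_itv (a b : R) (f : R -> R) : continuous f ->
  mu.-integrable (`]a, b[ : set mT) (EFin \o f).
Proof.
move=> cf; apply: (@integrableS _ _ _ mu `[a, b]) => //.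
  exact: subset_itv_oo_cc.
apply: continuous_compact_integrable; first exact: segment_compact.
exact: continuous_subspaceT.
Qed.

Lemma is_derive_affine (l k a t : R) :
  is_derive t (1 : R) (fun s : R => l + k * (s - a)) k.
Proof.
have h1 := is_deriveB (is_derive_id t (1 : R)) (is_derive_cst a t (1 : R)).
have h2 := is_deriveD (is_derive_cst l t (1 : R)) (is_deriveM (is_derive_cst k t (1 : R)) h1).
by apply: (is_derive_eq h2); rewrite scaler0 addr0 subr0 add0r [LHS]mulr1.
Qed.

(** The integrand is the first partial derivative of (l + k (x.1 - a)) phi. *)
Lemma green_affine1 (a b c d l k : R) (phi : R * R -> R) : a < b -> C1 phi ->
  integral_on (box a b c d)
    (fun x => (l + k * (x.1 - a)) * 'D_e1 phi x + k * phi x) =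
  (l + k * (b - a)) * (\int[mu]_(y in `]c, d[) phi (b, y)) -
  l * (\int[mu]_(y in `]c, d[) phi (a, y)).
Proof.
move=> ab cphi.
have dk (t : R) : is_derive t (1 : R) (fun s : R => l + k * (s - a)) k.
  exact: is_derive_affine.
have ck : continuous (fun _ : R => k) by move=> ?; exact: cvg_cst.
have ca : C1 (fun x : R * R => l + k * (x.1 - a)) by exact: (C1_fst_comp dk ck).
pose psi (x : R * R) := (l + k * (x.1 - a)) * phi x.
have cpsi : C1 psi by exact: C1_M.
transitivity (integral_on (box a b c d) ('D_e1 psi)).
  congr integral_on; apply/funext => x.
  rewrite /psi deriveM; [|exact: C1_derivable|exact: C1_derivable].
  by rewrite (derive_fst_comp dk) mul1r addrC [phi x *: _]mulrC addrC.
rewrite green1// /psi /= subrr mulr0 addr0.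
have cs z : continuous (fun y => phi (z, y)).
  by apply: continuous_slice2; exact: C1_continuous.
have iz z r : mu.-integrable (`]c, d[ : set mT) (EFin \o (fun y => r * phi (z, y))).
  apply: continuous_integrable_itv; apply: continuous_mul => // ?; exact: cvg_cst.
by rewrite RintegralB// !RintegralZl//; exact: continuous_integrable_itv.
Qed.

Lemma green_affine2 (a b c d l k : R) (phi : R * R -> R) : c < d -> C1 phi ->
  integral_on (box a b c d)
    (fun x => (l + k * (x.2 - c)) * 'D_e2 phi x + k * phi x) =
  (l + k * (d - c)) * (\int[mu]_(x in `]a, b[) phi (x, d)) -
  l * (\int[mu]_(x in `]a, b[) phi (x, c)).
Proof.
move=> ab cphi.
have dk (t : R) : is_derive t (1 : R) (fun s : R => l + k * (s - c)) k.
  exact: is_derive_affine.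
have ck : continuous (fun _ : R => k) by move=> ?; exact: cvg_cst.
have ca : C1 (fun x : R * R => l + k * (x.2 - c)) by exact: (C1_snd_comp dk ck).
pose psi (x : R * R) := (l + k * (x.2 - c)) * phi x.
have cpsi : C1 psi by exact: C1_M.
transitivity (integral_on (box a b c d) ('D_e2 psi)).
  congr integral_on; apply/funext => x.
  rewrite /psi deriveM; [|exact: C1_derivable|exact: C1_derivable].
  by rewrite (derive_snd_comp dk) mul1r addrC [phi x *: _]mulrC addrC.
rewrite green2// /psi /= subrr mulr0 addr0.
have cs z : continuous (fun y => phi (y, z)).
  by apply: continuous_slice1; exact: C1_continuous.
have iz z r : mu.-integrable (`]a, b[ : set mT) (EFin \o (fun y => r * phi (y, z))).
  apply: continuous_integrable_itv; apply: continuous_mul => // ?; exact: cvg_cst.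
by rewrite RintegralB// !RintegralZl//; exact: continuous_integrable_itv.
Qed.

End Green.

(** * Unions of pixels *)
Section Grid.
Context {R : realType}.
Notation mu := (@lebesgue_measure R).
Notation mu2 := (@mu2 R).

Definition grid (a b c d : nat) : set (R * R) := box a%:R b%:R c%:R d%:R.
Definition pix (i j : nat) : set (R * R) := grid i i.+1 j j.+1.

Definition ae_on (D : set (R * R)) (u v : R * R -> R) :=
  {ae mu2, forall x, D x -> u x = v x}.

#[global] Instance ae_mu2_filter : Filter (almost_everywhere mu2).
Proof. exact: (ae_filter_ringOfSetsType mu2). Qed.

#[global] Instance ae_mu2_filter_nbhs : Filter (nbhs (almost_everywhere mu2)).
Proof. exact: ae_mu2_filter. Qed.

Lemma measurable_grid a b c d : mplane R (grid a b c d).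
Proof. exact: measurable_box. Qed.
Hint Resolve measurable_grid : core.

Lemma measurable_pix i j : mplane R (pix i j).
Proof. exact: measurable_box. Qed.
Hint Resolve measurable_pix : core.

Lemma pix_sub a b c d i j : (a <= i < b)%N -> (c <= j < d)%N ->
  pix i j `<=` grid a b c d.
Proof.
move=> /andP[ai ib] /andP[cj jd] x /boxP[? ? ? ?]; apply/boxP.
have ? : a%:R <= i%:R :> R by rewrite ler_nat.
have ? : i.+1%:R <= b%:R :> R by rewrite ler_nat.
have ? : c%:R <= j%:R :> R by rewrite ler_nat.
have ? : j.+1%:R <= d%:R :> R by rewrite ler_nat.
by split; lra.
Qed.

Lemma box_vempty (a b c d : R) : b <= a -> box a b c d = set0.
Proof. by move=> ba; rewrite -subset0 => x /boxP[? ? ? ?]; rewrite /set0/=; lra. Qed.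

Lemma box_hempty (a b c d : R) : d <= c -> box a b c d = set0.
Proof. by move=> ba; rewrite -subset0 => x /boxP[? ? ? ?]; rewrite /set0/=; lra. Qed.

Lemma integral_grid_row a b c d (f : R * R -> \bar R) : (c <= d)%N ->
  mefun R (grid a b c d) f ->
  (\int[mu2]_(x in grid a b c d) f x =
   \sum_(c <= j < d) \int[mu2]_(x in grid a b j j.+1) f x)%E.
Proof.
elim: d => [|d IH].
  rewrite leqn0 => /eqP -> _; rewrite big_geq//.
  by rewrite /grid box_hempty ?integral_set0.
rewrite leq_eqVlt => /predU1P[-> _|cd mf].
  by rewrite big_geq// /grid box_hempty ?integral_set0.
rewrite big_nat_recr//= -IH//; last first.
  apply: measurable_funS mf => // x /boxP[? ? ? ?]; apply/boxP; split => //.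
  have : d%:R <= d.+1%:R :> R by rewrite ler_nat.
  by lra.
by rewrite /grid in mf *; apply: integral_box_hcut mf; rewrite ler_nat.
Qed.

Lemma integral_grid a b c d (f : R * R -> \bar R) : (a <= b)%N -> (c <= d)%N ->
  mefun R (grid a b c d) f ->
  (\int[mu2]_(x in grid a b c d) f x =
   \sum_(a <= i < b) \sum_(c <= j < d) \int[mu2]_(x in pix i j) f x)%E.
Proof.
move=> + cd; elim: b => [|b IH].
  rewrite leqn0 => /eqP -> _; rewrite big_geq//.
  by rewrite /grid box_vempty ?integral_set0.
rewrite leq_eqVlt => /predU1P[-> _|ab mf].
  by rewrite big_geq// /grid box_vempty ?integral_set0.
rewrite big_nat_recr//= -IH//; last first.
  apply: measurable_funS mf => // x /boxP[? ? ? ?]; apply/boxP; split => //.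
  have : b%:R <= b.+1%:R :> R by rewrite ler_nat.
  by lra.
rewrite /pix -integral_grid_row//; last first.
  apply: measurable_funS mf => // x /boxP[? ? ? ?]; apply/boxP; split => //.
  have : a%:R <= b%:R :> R by rewrite ler_nat.
  by lra.
by rewrite /grid in mf *; apply: integral_box_vcut mf; rewrite ler_nat.
Qed.

Lemma integrable_grid a b c d (u : R * R -> R) : (a <= b)%N -> (c <= d)%N ->
  mfun R (grid a b c d) u ->
  (forall i j, (a <= i < b)%N -> (c <= j < d)%N ->
     mu2.-integrable (pix i j) (EFin \o u)) ->
  mu2.-integrable (grid a b c d) (EFin \o u).
Proof.
move=> ab cd mu iu; apply/integrableP; split; first exact/measurable_EFinP.
rewrite integral_grid//; last by apply: measurableT_comp => //; exact/measurable_EFinP.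
rewrite big_nat_cond; apply: lte_sum_pinfty => i /andP[Hi _].
rewrite big_nat_cond; apply: lte_sum_pinfty => j /andP[Hj _].
by have /integrableP[] := iu i j Hi Hj.
Qed.

Lemma Rintegral_grid a b c d (u : R * R -> R) : (a <= b)%N -> (c <= d)%N ->
  mfun R (grid a b c d) u ->
  (forall i j, (a <= i < b)%N -> (c <= j < d)%N ->
     mu2.-integrable (pix i j) (EFin \o u)) ->
  integral_on (grid a b c d) u =
  \sum_(a <= i < b) \sum_(c <= j < d) integral_on (pix i j) u.
Proof.
move=> ab cd mu iu; rewrite integral_onE /Rintegral integral_grid//; last exact/measurable_EFinP.
rewrite big_nat_cond [in RHS]big_nat_cond.
have fin i j : (a <= i < b)%N -> (c <= j < d)%N ->
    (\int[mu2]_(x in pix i j) (u x)%:E)%E \is a fin_num.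
  by move=> Hi Hj; apply: integrable_fin_num => //; exact: iu.
rewrite -sum_fine => [|i /andP[Hi _]]; last first.
  by rewrite big_nat_cond; apply/sum_fin_numP => j _ /andP[Hj _]; exact: fin.
apply: eq_bigr => i /andP[Hi _].
rewrite big_nat_cond [in RHS]big_nat_cond.
by rewrite -sum_fine// => j /andP[Hj _]; exact: fin.
Qed.

Lemma ae_eq_Rintegral (D : set (R * R)) (u v : R * R -> R) : mplane R D ->
  mfun R D u -> mfun R D v -> ae_on D u v -> integral_on D u = integral_on D v.
Proof.
move=> mD mu mv uv; rewrite !integral_onE /Rintegral; congr fine.
apply: ae_eq_integral => //; try exact/measurable_EFinP.
by apply: filterS uv => x uv Dx; rewrite uv.
Qed.

Lemma ae_eq_integrable (D : set (R * R)) (u v : R * R -> R) : mplane R D ->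
  mfun R D u -> ae_on D u v ->
  mu2.-integrable D (EFin \o v) -> mu2.-integrable D (EFin \o u).
Proof.
move=> mD mu uv /integrableP[mv fv]; apply/integrableP; split; first exact/measurable_EFinP.
apply: le_lt_trans fv; rewrite le_eqVlt; apply/orP; left; apply/eqP.
apply: ae_eq_integral => //; try (by apply: measurableT_comp => //; exact/measurable_EFinP).
by apply: filterS uv => x uv Dx /=; rewrite uv.
Qed.

Lemma eq_ae_on (D : set (R * R)) (u v : R * R -> R) :
  (forall x, D x -> u x = v x) -> ae_on D u v.
Proof. by move=> uv; apply: aeW => x; exact: uv. Qed.

Lemma integral_on_sub (E D : set (R * R)) (u : R * R -> R) : E `<=` D ->
  (forall x, D x -> ~ E x -> u x = 0) -> integral_on D u = integral_on E u.
Proof.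
move=> ED u0; rewrite !integral_onE Rintegral_mkcond [RHS]Rintegral_mkcond.
congr Rintegral; apply/funext => x; rewrite !patchE.
case: ifPn; case: ifPn => //; rewrite ?inE ?notin_setE.
- by move=> nE Dx; rewrite u0.
- by move=> /ED.
Qed.

(** |g| <= 1 + g^2, and boxes have finite measure. *)
Lemma L2_integrable (D : set (R * R)) (a b c d : R) (g : R * R -> R) :
  mplane R D -> box a b c d `<=` D -> L2 D g ->
  mu2.-integrable (box a b c d) (EFin \o g).
Proof.
move=> mD BD /L2P[mg g2].
have mB : mplane R (box a b c d) by exact: measurable_box.
have mgB : mfun R (box a b c d) g by exact: measurable_funS mg.
have mg2 : mefun R D (fun x => (g x ^+ 2)%:E).
  by apply/measurable_EFinP; exact: measurable_funX.
have i1 : mu2.-integrable (box a b c d) (EFin \o (fun=> 1 : R)).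
  by apply: (@continuous_integrable_box _ _ _ _ _ (fun=> 1)) => ?; exact: cvg_cst.
have i2 : mu2.-integrable (box a b c d) (fun x => (g x ^+ 2)%:E).
  apply/integrableP; split; first exact: measurable_funS mg2.
  apply: le_lt_trans g2.
  under eq_integral do rewrite gee0_abs ?lee_fin ?sqr_ge0//.
  by apply: ge0_subset_integral => // x _; rewrite lee_fin sqr_ge0.
apply: (le_integrable mB _ _ (integrableD mB i1 i2)); first exact/measurable_EFinP.
move=> x _ /=; rewrite lee_fin (ger0_norm (_ : 0 <= 1 + g x ^+ 2)) ?addr_ge0 ?sqr_ge0//.
rewrite -real_normK ?num_real//.
have := normr_ge0 (g x); move: `|g x| => t t0; nra.
Qed.

Lemma integrable_mul_continuous (a b c d : R) (g phi : R * R -> R) :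
  mu2.-integrable (box a b c d) (EFin \o g) -> continuous phi ->
  mu2.-integrable (box a b c d) (EFin \o (fun x => g x * phi x)).
Proof.
move=> ig cphi; have mB : mplane R (box a b c d) by exact: measurable_box.
have [C phiC] := continuous_bounded_box a b c d cphi.
have mg : mfun R (box a b c d) g by apply/measurable_EFinP; exact: measurable_int ig.
have igC : mu2.-integrable (box a b c d) (EFin \o (fun x => C * g x)).
  by have := integrableZl mB C ig.
apply: le_integrable igC => //.
  by apply/measurable_EFinP; apply: measurable_funM => //; exact: continuous_measurable_plane.
move=> x Bx /=; rewrite lee_fin !normrM mulrC ler_wpM2r//.
by rewrite (le_trans (phiC x Bx))// ler_norm.
Qed.

End Grid.
#[export] Hint Resolve measurable_grid measurable_pix : core.

(** * Weak divergence on one pixel *)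
Section WeakDiv.
Context {R : realType}.
Notation mu := (@lebesgue_measure R).
Notation mu2 := (@mu2 R).
Notation mT := (measurableTypeR R).
Implicit Types (p : R * R -> R * R) (g phi : R * R -> R).

Definition pix_affine i j p (l k m n : R) :=
  forall x, pix i j x -> p x = (l + k * (x.1 - i%:R), m + n * (x.2 - j%:R)).

Definition vflux phi (i j : nat) : R := \int[mu]_(y in `]j%:R, j.+1%:R[) phi (i%:R, y).
Definition hflux phi (i j : nat) : R := \int[mu]_(x in `]i%:R, i.+1%:R[) phi (x, j%:R).

(** The outward flux through the boundary of the pixel, weighted by phi, of the field
given there by [pix_affine]. *)
Definition pix_flux (i j : nat) (l k m n : R) phi : R :=
  ((l + k) * vflux phi i.+1 j - l * vflux phi i j) +
  ((m + n) * hflux phi i j.+1 - m * hflux phi i j).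

Lemma continuous_affine1 (l k z : R) : continuous (fun x : R * R => l + k * (x.1 - z)).
Proof.
have dk (t : R) := is_derive_affine l k z t.
have ck : continuous (fun _ : R => k) by move=> ?; exact: cvg_cst.
exact: C1_continuous (C1_fst_comp dk ck).
Qed.

Lemma continuous_affine2 (l k z : R) : continuous (fun x : R * R => l + k * (x.2 - z)).
Proof.
have dk (t : R) := is_derive_affine l k z t.
have ck : continuous (fun _ : R => k) by move=> ?; exact: cvg_cst.
exact: C1_continuous (C1_snd_comp dk ck).
Qed.

#[local] Hint Resolve continuous_affine1 continuous_affine2 : core.

Lemma measurable_dot_grad (D : set (R * R)) p phi : mplane R D ->
  mfun R D (fun x => (p x).1) -> mfun R D (fun x => (p x).2) -> C1 phi ->
  mfun R D (dot_grad p phi).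
Proof.
move=> mD m1 m2 [_ c1 c2].
have q1 := continuous_measurable_plane mD c1.
have q2 := continuous_measurable_plane mD c2.
exact: (measurable_funD (measurable_funM m1 q1) (measurable_funM m2 q2)).
Qed.

Section OnePixel.
Variables (i j : nat) (p : R * R -> R * R) (l k m n : R).
Hypothesis pE : pix_affine i j p l k m n.

Let A1 phi (x : R * R) := (l + k * (x.1 - i%:R)) * 'D_e1 phi x + k * phi x.
Let A2 phi (x : R * R) := (m + n * (x.2 - j%:R)) * 'D_e2 phi x + n * phi x.

Let cA1 phi : C1 phi -> continuous (A1 phi).
Proof.
move=> cphi; have [_ c1 _] := cphi.
have ck : continuous (fun _ : R * R => k) by move=> ?; exact: cvg_cst.
exact: (continuous_add (continuous_mul (@continuous_affine1 _ _ _) c1)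
  (continuous_mul ck (C1_continuous cphi))).
Qed.

Let cA2 phi : C1 phi -> continuous (A2 phi).
Proof.
move=> cphi; have [_ _ c2] := cphi.
have ck : continuous (fun _ : R * R => n) by move=> ?; exact: cvg_cst.
exact: (continuous_add (continuous_mul (@continuous_affine2 _ _ _) c2)
  (continuous_mul ck (C1_continuous cphi))).
Qed.

Lemma measurable_pix_comp :
  mfun R (pix i j) (fun x => (p x).1) /\ mfun R (pix i j) (fun x => (p x).2).
Proof.
split.
- apply: (@eq_measurable_fun _ _ (mT * mT)%type R _ (fun x => l + k * (x.1 - i%:R))).
    by move=> x; rewrite inE => /pE ->.
  exact: continuous_measurable_plane.
- apply: (@eq_measurable_fun _ _ (mT * mT)%type R _ (fun x => m + n * (x.2 - j%:R))).
    by move=> x; rewrite inE => /pE ->.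
  exact: continuous_measurable_plane.
Qed.

Lemma integrable_pix_comp :
  mu2.-integrable (pix i j) (EFin \o (fun x => (p x).1 ^+ 2)) /\
  mu2.-integrable (pix i j) (EFin \o (fun x => (p x).2 ^+ 2)).
Proof.
have [m1 m2] := measurable_pix_comp; split.
- apply: (ae_eq_integrable (v := fun x => (l + k * (x.1 - i%:R)) ^+ 2)) => //.
  + exact: measurable_funX.
  + by apply: eq_ae_on => x /pE ->.
  + by apply: continuous_integrable_box; exact: (continuous_mul (@continuous_affine1 _ _ _) (@continuous_affine1 _ _ _)).
- apply: (ae_eq_integrable (v := fun x => (m + n * (x.2 - j%:R)) ^+ 2)) => //.
  + exact: measurable_funX.
  + by apply: eq_ae_on => x /pE ->.
  + by apply: continuous_integrable_box; exact: (continuous_mul (@continuous_affine2 _ _ _) (@continuous_affine2 _ _ _)).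
Qed.

Lemma integrable_pix_dot_grad phi : C1 phi ->
  mu2.-integrable (pix i j) (EFin \o dot_grad p phi).
Proof.
move=> cphi; have [m1 m2] := measurable_pix_comp; have [_ c1 c2] := cphi.
apply: (ae_eq_integrable (v := fun x =>
  (l + k * (x.1 - i%:R)) * 'D_e1 phi x + (m + n * (x.2 - j%:R)) * 'D_e2 phi x)) => //.
- exact: measurable_dot_grad.
- by apply: eq_ae_on => x /pE; rewrite /dot_grad => ->.
- apply: continuous_integrable_box.
  by apply: continuous_add; apply: continuous_mul.
Qed.

(** Green's formula on the pixel, with any almost everywhere representative g of
the divergence k + n. *)
Lemma pix_fluxE g phi : C1 phi -> mfun R (pix i j) g ->
  ae_on (pix i j) g (fun=> k + n) ->
  mu2.-integrable (pix i j) (EFin \o (fun x => g x * phi x)) /\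
  integral_on (pix i j) (fun x => dot_grad p phi x + g x * phi x) =
  pix_flux i j l k m n phi.
Proof.
move=> cphi mg gE; have [m1 m2] := measurable_pix_comp.
have cp := C1_continuous cphi.
have mphi : mfun R (pix i j) phi by exact: continuous_measurable_plane.
split.
  apply: (ae_eq_integrable (v := fun x => (k + n) * phi x)) => //.
  - exact: measurable_funM.
  - by apply: filterS gE => x gE Dx; rewrite gE.
  - apply: continuous_integrable_box; apply: continuous_mul => //.
    by move=> ?; exact: cvg_cst.
have iA1 : mu2.-integrable (pix i j) (EFin \o A1 phi).
  by apply: continuous_integrable_box; exact: cA1.
have iA2 : mu2.-integrable (pix i j) (EFin \o A2 phi).
  by apply: continuous_integrable_box; exact: cA2.
transitivity (integral_on (pix i j) (fun x => A1 phi x + A2 phi x)).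
  apply: ae_eq_Rintegral => //.
  - by apply: measurable_funD; [exact: measurable_dot_grad|exact: measurable_funM].
  - by apply: measurable_funD; apply: continuous_measurable_plane => //; [exact: cA1|exact: cA2].
  - apply: filterS gE => x gE Dx; rewrite gE// /dot_grad pE// /A1 /A2 /=; ring.
rewrite integral_onE RintegralD//.
have := @green_affine1 R i%:R i.+1%:R j%:R j.+1%:R l k phi.
rewrite integral_onE => ->//; last by rewrite ltr_nat.
have := @green_affine2 R i%:R i.+1%:R j%:R j.+1%:R m n phi.
rewrite integral_onE => ->//; last by rewrite ltr_nat.
by rewrite -!natr1 !(addrC _ 1) !addrK !mulr1 /pix_flux /vflux /hflux -!natr1 !(addrC _ 1).
Qed.

(** Test functions supported in the pixel have no boundary flux, so g - (k + n) is
orthogonal to all of them. *)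
Lemma weak_div_pix a b c d g : (a <= i < b)%N -> (c <= j < d)%N ->
  is_weak_div (grid a b c d) p g -> ae_on (pix i j) g (fun=> k + n).
Proof.
move=> Hi Hj [L2g wg]; have PD := @pix_sub R a b c d i j Hi Hj.
have ig : mu2.-integrable (pix i j) (EFin \o g).
  exact: L2_integrable (measurable_grid _ _ _ _) PD L2g.
have mg : mfun R (pix i j) g by apply/measurable_EFinP; exact: measurable_int ig.
have ic : mu2.-integrable (pix i j) (EFin \o (fun=> k + n : R)).
  by apply: continuous_integrable_box => ?; exact: cvg_cst.
have iw : mu2.-integrable (pix i j) (EFin \o (fun x => g x - (k + n))).
  exact: (integrableB (measurable_pix i j) ig ic).
suff : ae_eq mu2 (pix i j) (EFin \o (fun x => g x - (k + n))) (cst 0%E).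
  by apply: filterS => x h Dx; have := h Dx => -[] /eqP; rewrite subr_eq0 => /eqP.
apply: fundamental_lemma => // phi [cphi [A [cA AP] phiA]].
have cp := C1_continuous cphi.
have cphi' : C1c (grid a b c d) phi.
  by split=> //; exists A => //; split => // x /AP /PD.
have phi0 x : ~ pix i j x -> phi x = 0 by move=> nx; apply: phiA => /AP.
have oA : open (~` A).
  by apply: closed_openC; apply: compact_closed => //; exact: norm_hausdorff.
have D0 v x : ~ A x -> 'D_v phi x = 0.
  move=> nA; rewrite -(derive_cst (0 : R) x v); apply: near_eq_derive.
  have : nbhs x (~` A) by move: oA; rewrite openE; exact.
  by apply: filterS => y /phiA ->.
have dg0 x : ~ pix i j x -> dot_grad p phi x = 0.
  by move=> nx; rewrite /dot_grad !D0 ?mulr0 ?addr0// => /AP.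
have := wg phi cphi'.
rewrite (integral_on_sub PD) => [|x _ /dg0//].
rewrite (integral_on_sub PD) => [wE|x _ /phi0 ->]; last by rewrite mulr0.
have mc : mfun R (pix i j) (fun=> k + n) by exact: measurable_cst.
have [icp] := @pix_fluxE (fun=> k + n) phi cphi mc (eq_ae_on (fun x _ => erefl _)).
have idg := integrable_pix_dot_grad cphi.
have igp : mu2.-integrable (pix i j) (EFin \o (fun x => g x * phi x)).
  exact: integrable_mul_continuous.
rewrite integral_onE RintegralD// -!integral_onE wE.
have V0 i' : (i' = i \/ i' = i.+1) -> vflux phi i' j = 0.
  move=> ii; rewrite /vflux; under eq_Rintegral => y _.
    rewrite phi0; last by move=> /boxP[/=]; case: ii => ->; rewrite ?ltxx.
    over.
  by rewrite Rintegral_cst//= mul0r.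
have H0 j' : (j' = j \/ j' = j.+1) -> hflux phi i j' = 0.
  move=> jj; rewrite /hflux; under eq_Rintegral => y _.
    rewrite phi0; last by move=> /boxP[/=]; case: jj => ->; rewrite ?ltxx.
    over.
  by rewrite Rintegral_cst//= mul0r.
rewrite /pix_flux !V0; try by auto.
rewrite !H0; try by auto.
rewrite !mulr0 subrr addr0 => E.
rewrite (_ : (fun x => _) = (fun x => g x * phi x - (k + n) * phi x)); last first.
  by apply/funext => x; rewrite mulrBl.
rewrite integral_onE (RintegralB (measurable_pix i j) igp icp).
by apply/eqP; rewrite -oppr_eq0 opprB -E addrC.
Qed.

End OnePixel.

End WeakDiv.

(** * Normal traces of piecewise RT0 fields *)
Section Traces.
Context {R : realType}.
Notation mu := (@lebesgue_measure R).
Notation mu2 := (@mu2 R).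
Notation mT := (measurableTypeR R).
Implicit Types (p : R * R -> R * R) (g phi : R * R -> R).

Lemma integral_itv_gt0 (a b : R) (f : R -> R) : a < b -> continuous f ->
  (forall t, a < t < b -> 0 < f t) -> 0 < \int[mu]_(t in `]a, b[) f t.
Proof.
move=> ab cf f0.
have If := continuous_integrable_itv a b cf.
have mf : measurable_fun (`]a, b[ : set mT) (EFin \o f) by exact: measurable_int If.
have f0' t : `]a, b[%classic t -> 0 < f t by rewrite /= in_itv/=; exact: f0.
rewrite lt_neqAle Rintegral_ge0 ?andbT; last by move=> t /f0' /ltW.
apply/eqP => /esym I0.
have I0' : (\int[mu]_(t in `]a, b[) `|(EFin \o f) t| = 0)%E.
  under eq_integral => t tab.
    rewrite gee0_abs; last by rewrite lee_fin ltW//; apply: f0'; rewrite -inE.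
    over.
  by rewrite -(fineK (integrable_fin_num _ If))//; congr EFin.
have mI : measurable (`]a, b[ : set mT) by [].
have [N [mN N0 subN]] := (ae_eq_integral_abs mu mI mf).1 I0'.
have : (mu (`]a, b[ : set mT) <= mu N)%E.
  apply: le_measure; rewrite ?inE//.
  move=> t tab; apply: subN => /= /(_ tab) /eqP; rewrite eqe.
  by rewrite gt_eqF// f0'.
by rewrite N0 lebesgue_measure_itv/= lte_fin ab -EFinB lee_fin subr_le0 leNgt ab.
Qed.

Section GridFlux.
Variables (a b c d : nat) (p : R * R -> R * R) (l k m n : nat -> nat -> R).
Hypotheses (ab : (a <= b)%N) (cd : (c <= d)%N).
Hypotheses (mp1 : mfun R (grid a b c d) (fun x => (p x).1))
           (mp2 : mfun R (grid a b c d) (fun x => (p x).2)).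
Hypothesis pE : forall i j, (a <= i < b)%N -> (c <= j < d)%N ->
  pix_affine i j p (l i j) (k i j) (m i j) (n i j).

Lemma integrable_dot_grad phi : C1 phi ->
  mu2.-integrable (grid a b c d) (EFin \o dot_grad p phi).
Proof.
move=> cphi; apply: integrable_grid => //.
  exact: measurable_dot_grad.
by move=> i j Hi Hj; exact: (integrable_pix_dot_grad (pE Hi Hj)).
Qed.

Lemma grid_fluxE g phi : C1 phi -> mfun R (grid a b c d) g ->
  (forall i j, (a <= i < b)%N -> (c <= j < d)%N ->
     ae_on (pix i j) g (fun=> k i j + n i j)) ->
  mu2.-integrable (grid a b c d) (EFin \o (fun x => g x * phi x)) /\
  integral_on (grid a b c d) (fun x => dot_grad p phi x + g x * phi x) =
  \sum_(a <= i < b) \sum_(c <= j < d)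
     pix_flux i j (l i j) (k i j) (m i j) (n i j) phi.
Proof.
move=> cphi mg gE.
have mphi : mfun R (grid a b c d) phi.
  by apply: continuous_measurable_plane => //; exact: C1_continuous.
have mgP i j : (a <= i < b)%N -> (c <= j < d)%N -> mfun R (pix i j) g.
  by move=> Hi Hj; apply: measurable_funS mg => //; exact: pix_sub.
have F i j (Hi : (a <= i < b)%N) (Hj : (c <= j < d)%N) :=
  pix_fluxE (pE Hi Hj) cphi (mgP i j Hi Hj) (gE i j Hi Hj).
split.
  apply: integrable_grid => //; first exact: measurable_funM.
  by move=> i j Hi Hj; have [] := F i j Hi Hj.
rewrite Rintegral_grid//.
- rewrite big_nat_cond [RHS]big_nat_cond; apply: eq_bigr => i /andP[Hi _].
  rewrite big_nat_cond [RHS]big_nat_cond; apply: eq_bigr => j /andP[Hj _].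
  by have [] := F i j Hi Hj.
- by apply: measurable_funD; [exact: measurable_dot_grad|exact: measurable_funM].
- move=> i j Hi Hj; have [h _] := F i j Hi Hj.
  exact: (integrableD (measurable_pix i j) (integrable_pix_dot_grad (pE Hi Hj) cphi) h).
Qed.

End GridFlux.

(** The bump centred on a vertical edge meets no other edge of the pixels; testing
with it isolates the jump of the normal component across that edge.  For horizontal
edges the same is done by [hflux_hbump]. *)
Lemma vflux_vbump (i0 j0 i j : nat) :
  vflux (bump (i0%:R - 1) (i0%:R + 1) j0%:R (j0.+1)%:R) i j =
  if (i == i0) && (j == j0)
  then vflux (bump (i0%:R - 1) (i0%:R + 1) (j0%:R : R) (j0.+1)%:R) i0 j0 else 0.
Proof.
case: ifP => [/andP[/eqP-> /eqP->]//|ij].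
rewrite /vflux; under eq_Rintegral => y.
  rewrite inE/= in_itv/= => /andP[y1 y2].
  rewrite bump_eq0/=; first over.
  move=> [h1 h2 h3 h4]; move/negP: ij; apply; apply/andP; split; rewrite eqn_leq.
  - by rewrite -(ltnS i) -(ltnS i0) -!(ltr_nat R) -(natr1 i) -(natr1 i0); apply/andP; split; lra.
  - by rewrite -(ltnS j) -(ltnS j0) -!(ltr_nat R); apply/andP; split; lra.
by rewrite Rintegral_cst//= mul0r.
Qed.

Lemma hflux_vbump (i0 j0 i j : nat) :
  hflux (bump (i0%:R - 1) (i0%:R + 1) (j0%:R : R) (j0.+1)%:R) i j = 0.
Proof.
rewrite /hflux; under eq_Rintegral => y _.
  rewrite bump_eq0/=; first over.
  move=> [_ _]; rewrite !ltr_nat ltnS => h1 h2.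
  by move: (leq_trans h1 h2); rewrite ltnn.
by rewrite Rintegral_cst//= mul0r.
Qed.

Lemma vflux_vbump_gt0 (i0 j0 : nat) :
  0 < vflux (bump (i0%:R - 1) (i0%:R + 1) (j0%:R : R) (j0.+1)%:R) i0 j0.
Proof.
apply: integral_itv_gt0; first by rewrite ltr_nat.
  by apply: continuous_slice2; apply: C1_continuous; exact: bump_C1.
by move=> t /andP[? ?]; apply: bump_gt0 => //=; lra.
Qed.

Lemma hflux_hbump (i0 j0 i j : nat) :
  hflux (bump i0%:R (i0.+1)%:R (j0%:R - 1) (j0%:R + 1)) i j =
  if (i == i0) && (j == j0)
  then hflux (bump i0%:R (i0.+1)%:R (j0%:R - 1) (j0%:R + 1 : R)) i0 j0 else 0.
Proof.
case: ifP => [/andP[/eqP-> /eqP->]//|ij].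
rewrite /hflux; under eq_Rintegral => y.
  rewrite inE/= in_itv/= => /andP[y1 y2].
  rewrite bump_eq0/=; first over.
  move=> [h1 h2 h3 h4]; move/negP: ij; apply; apply/andP; split; rewrite eqn_leq.
  - by rewrite -(ltnS i) -(ltnS i0) -!(ltr_nat R); apply/andP; split; lra.
  - by rewrite -(ltnS j) -(ltnS j0) -!(ltr_nat R) -(natr1 j) -(natr1 j0); apply/andP; split; lra.
by rewrite Rintegral_cst//= mul0r.
Qed.

Lemma vflux_hbump (i0 j0 i j : nat) :
  vflux (bump i0%:R (i0.+1)%:R (j0%:R - 1) (j0%:R + 1 : R)) i j = 0.
Proof.
rewrite /vflux; under eq_Rintegral => y _.
  rewrite bump_eq0/=; first over.
  move=> [+ + _ _]; rewrite !ltr_nat ltnS => h1 h2.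
  by move: (leq_trans h1 h2); rewrite ltnn.
by rewrite Rintegral_cst//= mul0r.
Qed.

Lemma hflux_hbump_gt0 (i0 j0 : nat) :
  0 < hflux (bump i0%:R (i0.+1)%:R (j0%:R - 1) (j0%:R + 1 : R)) i0 j0.
Proof.
apply: integral_itv_gt0; first by rewrite ltr_nat.
  by apply: continuous_slice1; apply: C1_continuous; exact: bump_C1.
by move=> t /andP[? ?]; apply: bump_gt0 => //=; lra.
Qed.

(** Piecewise RT0 fields of H0(div) on a grid, described by edge values: v i j is the
normal component on the vertical edge at x.1 = i in row j, and h i j the one on the
horizontal edge at x.2 = j in column i.  One value per edge expresses the normal
continuity.  Measurability is a separate condition because nothing else constrains
the field on the grid lines. *)
Definition traced a b c d p (v h : nat -> nat -> R) : Prop :=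
  [/\ mfun R (grid a b c d) (fun x => (p x).1),
      mfun R (grid a b c d) (fun x => (p x).2),
      forall i j, (a <= i < b)%N -> (c <= j < d)%N ->
        pix_affine i j p (v i j) (v i.+1 j - v i j) (h i j) (h i j.+1 - h i j),
      forall j, (c <= j < d)%N -> v a j = 0 /\ v b j = 0 &
      forall i, (a <= i < b)%N -> h i c = 0 /\ h i d = 0].

Definition rt_div (v h : nat -> nat -> R) i j : R :=
  (v i.+1 j - v i j) + (h i j.+1 - h i j).

Lemma is_weak_div_div D p : Hdiv D p -> is_weak_div D p (div D p).
Proof. by move=> [_ _ [g gP]]; rewrite /div; apply: (getPex (ex_intro _ g gP)). Qed.

Lemma sum_delta2 a b c d i0 j0 (F : nat -> nat -> R) (K : R) :
  \sum_(a <= i < b) \sum_(c <= j < d)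
     F i j * (if (i == i0) && (j == j0) then K else 0) =
  if (a <= i0 < b)%N && (c <= j0 < d)%N then F i0 j0 * K else 0.
Proof.
have E i : \sum_(c <= j < d) F i j * (if (i == i0) && (j == j0) then K else 0) =
    if i == i0 then (if (c <= j0 < d)%N then F i0 j0 * K else 0) else 0.
  have [->|ii] := eqVneq i i0; last by rewrite big1// => j _; rewrite mulr0.
  rewrite -(@big_nat1_eq R 0 +%R (fun j => F i0 j * K)) [RHS]big_mkcond/=.
  by apply: eq_bigr => j _; case: ifP; rewrite ?mulr0.
rewrite (eq_bigr _ (fun i _ => E i)) -big_mkcond big_nat1_eq.
by case: (_ <= _ < b)%N.
Qed.

(** The sum of the pixel fluxes of phi is the normal trace tested with phi, hence
vanishes.  With phi a bump around one edge only the traces of the field from the two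
sides of that edge remain, or a single trace on the boundary. *)
Lemma H0div_traced a b c d p : (a <= b)%N -> (c <= d)%N ->
  H0div (grid a b c d) p ->
  (forall i j, (a <= i < b)%N -> (c <= j < d)%N -> RT0 (pix i j) p) ->
  exists v h, traced a b c d p v h.
Proof.
move=> ab cd [Hp tr0] rt.
have [[mp1 _] [mp2 _] _] := Hp.
have wd := is_weak_div_div Hp.
have /choice[q qP] : forall ij : nat * nat, exists q : R * R * (R * R),
    (a <= ij.1 < b)%N -> (c <= ij.2 < d)%N ->
    pix_affine ij.1 ij.2 p q.1.1 q.1.2 q.2.1 q.2.2.
  move=> [i j] /=.
  have [Hi|Hi] := boolP (a <= i < b)%N; last by exists (0, 0, (0, 0)).
  have [Hj|Hj] := boolP (c <= j < d)%N; last by exists (0, 0, (0, 0)).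
  have [a1 [b1 [a2 [b2 pE]]]] := rt i j Hi Hj.
  exists (a1 + b1 * i%:R, b1, (a2 + b2 * j%:R, b2)) => _ _ x /pE ->/=.
  by congr (_, _); ring.
pose l i j := (q (i, j)).1.1; pose k i j := (q (i, j)).1.2.
pose m i j := (q (i, j)).2.1; pose n i j := (q (i, j)).2.2.
have pE i j (Hi : (a <= i < b)%N) (Hj : (c <= j < d)%N) :
  pix_affine i j p (l i j) (k i j) (m i j) (n i j) := qP (i, j) Hi Hj.
have mg : mfun R (grid a b c d) (div (grid a b c d) p) by case: wd => [[]].
have gE i j (Hi : (a <= i < b)%N) (Hj : (c <= j < d)%N) := weak_div_pix (pE i j Hi Hj) Hi Hj wd.
have flux0 phi : C1 phi -> \sum_(a <= i < b) \sum_(c <= j < d)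
     pix_flux i j (l i j) (k i j) (m i j) (n i j) phi = 0.
  move=> cphi; have [_ <-] := grid_fluxE ab cd mp1 mp2 pE cphi mg gE.
  exact: tr0.
(* The two conditionals are the traces at x.1 = i0 from the left and from the right,
   0 when there is no pixel on that side. *)
have vE i0 j0 : (c <= j0 < d)%N ->
    (if (a < i0 <= b)%N then l i0.-1 j0 + k i0.-1 j0 else 0) =
    (if (a <= i0 < b)%N then l i0 j0 else 0).
  move=> Hj0; have := flux0 _ (bump_C1 (i0%:R - 1) (i0%:R + 1) j0%:R (j0.+1)%:R).
  have K0 := vflux_vbump_gt0 i0 j0.
  set phi := bump _ _ _ _ in K0 *; set K := vflux phi i0 j0 in K0.
  have E i j : pix_flux i j (l i j) (k i j) (m i j) (n i j) phi =
      (l i j + k i j) * (if (i.+1 == i0) && (j == j0) then K else 0) -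
      l i j * (if (i == i0) && (j == j0) then K else 0).
    rewrite /pix_flux !hflux_vbump !mulr0 subrr addr0.
    by rewrite (vflux_vbump i0 j0 i.+1 j) (vflux_vbump i0 j0 i j).
  under eq_bigr => i _.
    under eq_bigr => j _ do rewrite E.
    rewrite sumrB; over.
  rewrite sumrB sum_delta2 Hj0 andbT => /subr0_eq.
  have -> : \sum_(a <= i < b) \sum_(c <= j < d) (l i j + k i j) *
       (if (i.+1 == i0) && (j == j0) then K else 0) =
     \sum_(a.+1 <= i < b.+1) \sum_(c <= j < d) (l i.-1 j + k i.-1 j) *
       (if (i == i0) && (j == j0) then K else 0).
    by rewrite big_add1.
  rewrite (@sum_delta2 _ _ _ _ i0 j0 (fun i j => l i.-1 j + k i.-1 j)) Hj0 andbT ltnS.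
  have cK x y : x * K = y * K -> x = y by apply: mulIf; rewrite gt_eqF.
  case: ifP => _; case: ifP => _; rewrite ?(mul0r K)//.
  - exact: cK.
  - by move=> xK; apply: cK; rewrite xK mul0r.
  - by move=> xK; apply: cK; rewrite -xK mul0r.
have hE i0 j0 : (a <= i0 < b)%N ->
    (if (c < j0 <= d)%N then m i0 j0.-1 + n i0 j0.-1 else 0) =
    (if (c <= j0 < d)%N then m i0 j0 else 0).
  move=> Hi0; have := flux0 _ (bump_C1 i0%:R (i0.+1)%:R (j0%:R - 1) (j0%:R + 1)).
  have K0 := hflux_hbump_gt0 i0 j0.
  set phi := bump _ _ _ _ in K0 *; set K := hflux phi i0 j0 in K0.
  have E i j : pix_flux i j (l i j) (k i j) (m i j) (n i j) phi =
      (m i j + n i j) * (if (i == i0) && (j.+1 == j0) then K else 0) -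
      m i j * (if (i == i0) && (j == j0) then K else 0).
    rewrite /pix_flux !vflux_hbump !mulr0 subrr add0r.
    by rewrite (hflux_hbump i0 j0 i j.+1) (hflux_hbump i0 j0 i j).
  under eq_bigr => i _.
    under eq_bigr => j _ do rewrite E.
    rewrite sumrB; over.
  rewrite sumrB sum_delta2 Hi0/= => /subr0_eq.
  have -> : \sum_(a <= i < b) \sum_(c <= j < d) (m i j + n i j) *
       (if (i == i0) && (j.+1 == j0) then K else 0) =
     \sum_(a <= i < b) \sum_(c.+1 <= j < d.+1) (m i j.-1 + n i j.-1) *
       (if (i == i0) && (j == j0) then K else 0).
    by apply: eq_bigr => i _; rewrite big_add1.
  rewrite (@sum_delta2 _ _ _ _ i0 j0 (fun i j => m i j.-1 + n i j.-1)) Hi0/= ltnS.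
  have cK x y : x * K = y * K -> x = y by apply: mulIf; rewrite gt_eqF.
  case: ifP => _; case: ifP => _; rewrite ?(mul0r K)//.
  - exact: cK.
  - by move=> xK; apply: cK; rewrite xK mul0r.
  - by move=> xK; apply: cK; rewrite -xK mul0r.
pose v i j := if (a <= i < b)%N then l i j else 0.
pose h i j := if (c <= j < d)%N then m i j else 0.
exists v, h; split => //.
- move=> i j Hi Hj x /(pE i j Hi Hj) ->.
  have -> : v i.+1 j = l i j + k i j.
    by rewrite /v -vE//=; move: Hi; case/andP => ai ib; rewrite ltnS ai ib.
  have -> : h i j.+1 = m i j + n i j.
    by rewrite /h -hE//=; move: Hj; case/andP => ai ib; rewrite ltnS ai ib.
  by rewrite /v /h Hi Hj; congr (_, _); ring.
- by move=> j Hj; split; [rewrite /v -vE// ltnn|rewrite /v ltnn andbF].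
- by move=> i Hi; split; [rewrite /h -hE// ltnn|rewrite /h ltnn andbF].
Qed.

Definition piecewise a b c d (F : nat -> nat -> R * R -> R) (x : R * R) : R :=
  \sum_(a <= i < b) \sum_(c <= j < d) F i j x * \1_(pix i j) x.

Lemma measurable_piecewise a b c d (F : nat -> nat -> R * R -> R) :
  (forall i j, continuous (F i j)) -> mfun R setT (piecewise a b c d F).
Proof.
move=> cF; apply: measurable_sum => i; apply: measurable_sum => j.
apply: measurable_funM; first exact: continuous_measurable_plane.
by apply: measurable_indic.
Qed.

Lemma pix_inj i j i' j' (x : R * R) : pix i j x -> pix i' j' x -> i = i' /\ j = j'.
Proof.
move=> /boxP[h1 h2 h3 h4] /boxP[h5 h6 h7 h8].
have q1 := lt_trans h1 h6; have q2 := lt_trans h5 h2.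
have q3 := lt_trans h3 h8; have q4 := lt_trans h7 h4.
move: q1 q2 q3 q4; rewrite !ltr_nat !ltnS => q1 q2 q3 q4.
by split; apply/eqP; rewrite eqn_leq ?q1 ?q2 ?q3 ?q4.
Qed.

Lemma piecewiseE a b c d F i j (x : R * R) : (a <= i < b)%N -> (c <= j < d)%N ->
  pix i j x -> piecewise a b c d F x = F i j x.
Proof.
move=> Hi Hj px; rewrite /piecewise.
have E i' j' : F i' j' x * \1_(pix i' j') x =
    F i' j' x * (if (i' == i) && (j' == j) then 1 else 0).
  congr (_ * _); rewrite indicE; case: ifPn => [/andP[/eqP-> /eqP->]|ij].
    by rewrite mem_set.
  rewrite memNset// => px'; have [ii jj] := pix_inj px px'.
  by rewrite ii jj !eqxx in ij.
under eq_bigr => i' _ do under eq_bigr => j' _ do rewrite E.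
by rewrite (@sum_delta2 _ _ _ _ i j (fun i j => F i j x)) Hi Hj mulr1.
Qed.

Section Traced.
Variables (a b c d : nat) (p : R * R -> R * R) (v h : nat -> nat -> R).
Hypotheses (ab : (a <= b)%N) (cd : (c <= d)%N) (tp : traced a b c d p v h).

Let mp1 : mfun R (grid a b c d) (fun x => (p x).1). Proof. by case: tp. Qed.
Let mp2 : mfun R (grid a b c d) (fun x => (p x).2). Proof. by case: tp. Qed.
Let pE i j (Hi : (a <= i < b)%N) (Hj : (c <= j < d)%N) :
  pix_affine i j p (v i j) (v i.+1 j - v i j) (h i j) (h i j.+1 - h i j).
Proof. by case: tp => _ _ + _ _; exact. Qed.

Lemma traced_weak_div g : is_weak_div (grid a b c d) p g ->
  forall i j, (a <= i < b)%N -> (c <= j < d)%N ->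
  ae_on (pix i j) g (fun=> rt_div v h i j).
Proof.
by move=> wg i j Hi Hj; rewrite /rt_div; exact: (weak_div_pix (pE Hi Hj) Hi Hj wg).
Qed.

(** In each row and column the edge contributions telescope to the boundary values,
which are 0. *)
Lemma traced_flux g phi : C1 phi -> mfun R (grid a b c d) g ->
  (forall i j, (a <= i < b)%N -> (c <= j < d)%N ->
     ae_on (pix i j) g (fun=> rt_div v h i j)) ->
  mu2.-integrable (grid a b c d) (EFin \o (fun x => g x * phi x)) /\
  integral_on (grid a b c d) (fun x => dot_grad p phi x + g x * phi x) = 0.
Proof.
move=> cphi mg gE; have [ig ->] := grid_fluxE ab cd mp1 mp2 pE cphi mg gE.
split=> //; have [_ _ _ v0 h0] := tp.
have E i j : pix_flux i j (v i j) (v i.+1 j - v i j) (h i j) (h i j.+1 - h i j) phi =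
   (v i.+1 j * vflux phi i.+1 j - v i j * vflux phi i j) +
   (h i j.+1 * hflux phi i j.+1 - h i j * hflux phi i j).
  by rewrite /pix_flux (addrC (v i j)) (addrC (h i j)) !subrK.
under eq_bigr => i _.
  under eq_bigr => j _ do rewrite E.
  rewrite big_split/=; over.
rewrite big_split/= exchange_big/= big_nat_cond big1 ?add0r => [|j /andP[Hj _]].
  rewrite big_nat_cond big1// => i /andP[Hi _].
  rewrite (telescope_sumr (fun j => h i j * hflux phi i j) cd).
  by have [-> ->] := h0 i Hi; rewrite !mul0r subrr.
rewrite (telescope_sumr (fun i => v i j * vflux phi i j) ab).
by have [-> ->] := v0 j Hj; rewrite !mul0r subrr.
Qed.

Let g0 := piecewise a b c d (fun i j (_ : R * R) => rt_div v h i j).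

Let mg0 : mfun R (grid a b c d) g0.
Proof.
apply: measurable_funS (measurable_piecewise a b c d _) => //.
by move=> i j ?; exact: cvg_cst.
Qed.

Let g0E i j x : (a <= i < b)%N -> (c <= j < d)%N -> pix i j x -> g0 x = rt_div v h i j.
Proof. exact: piecewiseE. Qed.

Let L2_pix (u : R * R -> R) : mfun R (grid a b c d) u ->
  (forall i j, (a <= i < b)%N -> (c <= j < d)%N ->
     mu2.-integrable (pix i j) (EFin \o (fun x => u x ^+ 2))) ->
  L2 (grid a b c d) u.
Proof.
move=> mu iu; apply/L2P; split=> //.
have mu2 : mfun R (grid a b c d) (fun x => u x ^+ 2) by exact: measurable_funX.
have /integrableP[_] := integrable_grid ab cd mu2 iu.
by under eq_integral do rewrite /= ger0_norm ?sqr_ge0//.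
Qed.

Lemma traced_is_weak_div : is_weak_div (grid a b c d) p g0.
Proof.
have aeg0 i j : (a <= i < b)%N -> (c <= j < d)%N -> ae_on (pix i j) g0 (fun=> rt_div v h i j).
  by move=> Hi Hj; apply: eq_ae_on => x; exact: g0E.
split.
  apply: L2_pix => // i j Hi Hj.
  apply: (ae_eq_integrable (v := fun=> rt_div v h i j ^+ 2)) => //.
  - by apply: measurable_funX; apply: measurable_funS mg0 => //; exact: pix_sub.
  - by apply: eq_ae_on => x px; rewrite (g0E Hi Hj px).
  - by apply: continuous_integrable_box => ?; exact: cvg_cst.
move=> phi [cphi _]; have [ig] := traced_flux cphi mg0 aeg0.
rewrite integral_onE (RintegralD (measurable_grid _ _ _ _) _ ig); last first.
  exact: (integrable_dot_grad ab cd mp1 mp2 pE).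
by move=> /eqP; rewrite addr_eq0 => /eqP.
Qed.

Lemma traced_H0div : H0div (grid a b c d) p.
Proof.
have Hp : Hdiv (grid a b c d) p.
  split; last by exists g0; exact: traced_is_weak_div.
  - by apply: L2_pix => // i j Hi Hj; have [] := integrable_pix_comp (pE Hi Hj).
  - by apply: L2_pix => // i j Hi Hj; have [] := integrable_pix_comp (pE Hi Hj).
have wd := is_weak_div_div Hp.
split=> // phi cphi; have [] := @traced_flux (div (grid a b c d) p) phi cphi => //.
- by case: wd => [[]].
- exact: traced_weak_div.
Qed.

Lemma traced_RT0 i j : (a <= i < b)%N -> (c <= j < d)%N -> RT0 (pix i j) p.
Proof.
move=> Hi Hj; exists (v i j - (v i.+1 j - v i j) * i%:R), (v i.+1 j - v i j),
  (h i j - (h i j.+1 - h i j) * j%:R), (h i j.+1 - h i j).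
by move=> x /(pE Hi Hj) ->; congr (_, _); ring.
Qed.

End Traced.

Lemma traced_exists a b c d (v h : nat -> nat -> R) :
  (forall j, (c <= j < d)%N -> v a j = 0 /\ v b j = 0) ->
  (forall i, (a <= i < b)%N -> h i c = 0 /\ h i d = 0) ->
  exists p, traced a b c d p v h.
Proof.
move=> v0 h0.
pose F1 i j (x : R * R) := v i j + (v i.+1 j - v i j) * (x.1 - i%:R).
pose F2 i j (x : R * R) := h i j + (h i j.+1 - h i j) * (x.2 - j%:R).
have cF1 i j : continuous (F1 i j) by exact: continuous_affine1.
have cF2 i j : continuous (F2 i j) by exact: continuous_affine2.
exists (fun x => (piecewise a b c d F1 x, piecewise a b c d F2 x)).
split => //.
- by apply: measurable_funS (measurable_piecewise a b c d cF1).
- by apply: measurable_funS (measurable_piecewise a b c d cF2).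
- by move=> i j Hi Hj x px; rewrite !(piecewiseE _ Hi Hj px).
Qed.

Lemma traced_eq a b c d p (v h v' h' : nat -> nat -> R) :
  (a <= b)%N -> (c <= d)%N ->
  (forall i j, (a <= i <= b)%N -> (c <= j < d)%N -> v i j = v' i j) ->
  (forall i j, (a <= i < b)%N -> (c <= j <= d)%N -> h i j = h' i j) ->
  traced a b c d p v h -> traced a b c d p v' h'.
Proof.
move=> ab cd vv hh [m1 m2 pE v0 h0]; split=> //.
- move=> i j Hi Hj x px; rewrite (pE i j Hi Hj x px).
  case/andP: (Hi) => ai ib; case/andP: (Hj) => cj jd.
  by rewrite !vv ?hh// ?ai ?cj ?(ltnW ib) ?(ltnW jd) ?(leqW ai) ?(leqW cj).
- by move=> j Hj; have := v0 j Hj; rewrite !vv// ?leqnn ?ab.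
- by move=> i Hi; have := h0 i Hi; rewrite !hh// ?leqnn ?cd.
Qed.

Lemma traced_lin a b c d p q v h v' h' (s t : R) :
  traced a b c d p v h -> traced a b c d q v' h' ->
  traced a b c d (fun x => s *: p x + t *: q x)
    (fun i j => s * v i j + t * v' i j) (fun i j => s * h i j + t * h' i j).
Proof.
move=> [mp1 mp2 pE pv ph] [mq1 mq2 qE qv qh]; split.
- by apply: measurable_funD; apply: measurable_funM.
- by apply: measurable_funD; apply: measurable_funM.
- move=> i j Hi Hj x px; rewrite (pE i j Hi Hj x px) (qE i j Hi Hj x px).
  by apply: injective_projections; rewrite /= /GRing.scale/=; ring.
- by move=> j Hj; have [-> ->] := pv j Hj; have [-> ->] := qv j Hj; rewrite !mulr0 addr0.
- by move=> j Hj; have [-> ->] := ph j Hj; have [-> ->] := qh j Hj; rewrite !mulr0 addr0.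
Qed.

End Traces.

(** * Degrees of freedom *)
Section Discrete.
Context {R : realType} (M N : nat).
Notation mu := (@lebesgue_measure R).
Notation mu2 := (@mu2 R).
Notation E := (edge M N).
Implicit Types (p q : field R) (c : E -> R).

(** The degrees of freedom c, indexed as in [traced] and extended by 0 to the edges of
the boundary. *)
Definition vdof c (i j : nat) : R :=
  if i is i'.+1 then
    if (insub i', insub j) is (Some i0, Some j0) then c (inl (i0, j0)) else 0
  else 0.

Definition hdof c (i j : nat) : R :=
  if j is j'.+1 then
    if (insub i, insub j') is (Some i0, Some j0) then c (inr (i0, j0)) else 0
  else 0.

Lemma vdof_edge c (i : 'I_M.-1) (j : 'I_N) : vdof c i.+1 j = c (inl (i, j)).
Proof. by rewrite /vdof !valK. Qed.

Lemma hdof_edge c (i : 'I_M) (j : 'I_N.-1) : hdof c i j.+1 = c (inr (i, j)).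
Proof. by rewrite /hdof !valK. Qed.

Lemma vdof_bdry c j : vdof c 0 j = 0 /\ vdof c M j = 0.
Proof.
split=> //; suff H i : (M <= i)%N -> vdof c i j = 0 by exact: H.
by case: i => // i Mi; rewrite /vdof insubF//; lia.
Qed.

Lemma hdof_bdry c i : hdof c i 0 = 0 /\ hdof c i N = 0.
Proof.
split=> //; suff H j : (N <= j)%N -> hdof c i j = 0 by exact: H.
by case: j => // j Nj; rewrite /hdof; case: insub => // ?; rewrite insubF//; lia.
Qed.

Lemma vdof_lin c c' (s t : R) i j :
  vdof (fun e => s * c e + t * c' e) i j = s * vdof c i j + t * vdof c' i j.
Proof.
case: i => [|i] /=; first by rewrite !mulr0 addr0.
by case: insub => [?|]; [case: insub => [?|]|]; rewrite ?mulr0 ?addr0.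
Qed.

Lemma hdof_lin c c' (s t : R) i j :
  hdof (fun e => s * c e + t * c' e) i j = s * hdof c i j + t * hdof c' i j.
Proof.
case: j => [|j] /=; first by rewrite !mulr0 addr0.
by case: insub => [?|]; [case: insub => [?|]|]; rewrite ?mulr0 ?addr0.
Qed.

Lemma OmegaE : Omega M N = grid 0 M 0 N :> set (R * R).
Proof. by []. Qed.

(** The line normal to an edge crosses two pixels, with possibly different slopes. *)
Lemma lim_two_sided (f : R -> R) (z L k1 k2 : R) :
  (\forall t \near z^'-, f t = L + k1 * (t - z)) ->
  (\forall t \near z^'+, f t = L + k2 * (t - z)) ->
  lim (f t @[t --> z^']) = L.
Proof.
move=> fl fr; apply: cvg_lim => //.
have c k : (L + k * (t - z)) @[t --> z] --> L.
  have [dL _] := is_derive_affine L k z z.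
  have /differentiable_continuous : differentiable (fun s : R => L + k * (s - z)) z.
    exact/derivable1_diffP.
  move=> h; have E : L + k * (z - z) = L by rewrite subrr mulr0 addr0.
  by rewrite -[X in _ --> X]E; exact: h.
apply: (@cvg_at_right_left_dnbhs _ R^o).
- have /cvg_trans : f t @[t --> z^'+] `=>` (L + k2 * (t - z)) @[t --> z^'+].
    by apply: near_eq_cvg; apply: filterS fr => t ->.
  by apply; apply: cvg_at_right_filter; exact: c.
- have /cvg_trans : f t @[t --> z^'-] `=>` (L + k1 * (t - z)) @[t --> z^'-].
    by apply: near_eq_cvg; apply: filterS fl => t ->.
  by apply; apply: cvg_at_left_filter; exact: c.
Qed.

Lemma dof_traced p (v h : nat -> nat -> R) : traced 0 M 0 N p v h ->
  (forall (i : 'I_M.-1) (j : 'I_N), dof p (inl (i, j)) = v i.+1 j) /\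
  (forall (i : 'I_M) (j : 'I_N.-1), dof p (inr (i, j)) = h i j.+1).
Proof.
move=> [_ _ pE _ _]; split=> i j.
- have iM : (i.+1 < M)%N by rewrite -ltn_predRL.
  have jj : j.+1%:R = j%:R + 1 :> R by rewrite natr1.
  apply: (@lim_two_sided _ _ _ (v i.+1 j - v i j) (v i.+2 j - v i.+1 j)).
  + near=> t; rewrite (pE i j)//=; first by rewrite -natr1; ring.
    * exact: ltnW.
    * have t1 : i%:R < t by near: t; apply: nbhs_left_gt; rewrite ltr_nat.
      have t2 : t < i.+1%:R by near: t; apply: nbhs_left_lt.
      by apply/boxP; split => //=; lra.
  + near=> t; rewrite (pE i.+1 j)//=.
    have t1 : i.+1%:R < t by near: t; apply: nbhs_right_gt.
    have t2 : t < i.+2%:R by near: t; apply: nbhs_right_lt; rewrite ltr_nat.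
    by apply/boxP; split => //=; lra.
- have jN : (j.+1 < N)%N by rewrite -ltn_predRL.
  have jj : i.+1%:R = i%:R + 1 :> R by rewrite natr1.
  apply: (@lim_two_sided _ _ _ (h i j.+1 - h i j) (h i j.+2 - h i j.+1)).
  + near=> t; rewrite (pE i j)//=; first by rewrite -natr1; ring.
    * exact: ltnW.
    * have t1 : j%:R < t by near: t; apply: nbhs_left_gt; rewrite ltr_nat.
      have t2 : t < j.+1%:R by near: t; apply: nbhs_left_lt.
      by apply/boxP; split => //=; lra.
  + near=> t; rewrite (pE i j.+1)//=.
    have t1 : j.+1%:R < t by near: t; apply: nbhs_right_gt.
    have t2 : t < j.+2%:R by near: t; apply: nbhs_right_lt; rewrite ltr_nat.
    by apply/boxP; split => //=; lra.
Unshelve. all: by end_near. Qed.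

(** Equivalent to membership in Y with degrees of freedom c, but linear in (p, c) by
inspection. *)
Definition has_dof p c := traced 0 M 0 N p (vdof c) (hdof c).

Lemma has_dofE p c : has_dof p c -> dof p = c.
Proof.
move=> pc; have [dv dh] := dof_traced pc.
by apply/funext => -[[i j]|[i j]]; rewrite ?dv ?dh ?vdof_edge ?hdof_edge.
Qed.

Lemma Y_has_dof p : Y M N p -> has_dof p (dof p).
Proof.
move=> [Hp rt]; have [v [h pvh]] : exists v h, traced 0 M 0 N p v h.
  apply: H0div_traced => // i j Hi Hj.
  exact: (rt (Ordinal (Hi : (i < M)%N), Ordinal (Hj : (j < N)%N))).
have [dv dh] := dof_traced pvh.
have [_ _ _ v0 h0] := pvh.
apply: traced_eq pvh => //.
- move=> [|i] j Hi Hj; first by have [-> _] := v0 j Hj.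
  have [iM|iM] := ltnP i M.-1.
    by rewrite -[i]/(val (Ordinal iM)) -[j]/(val (Ordinal (Hj : (j < N)%N))) vdof_edge dv.
  have -> : i.+1 = M by move: Hi iM; clear; lia.
  by have [_ ->] := v0 j Hj; have [_ ->] := vdof_bdry (dof p) j.
- move=> i [|j] Hi Hj; first by have [-> _] := h0 i Hi.
  have [jN|jN] := ltnP j N.-1.
    by rewrite -[j]/(val (Ordinal jN)) -[i]/(val (Ordinal (Hi : (i < M)%N))) hdof_edge dh.
  have -> : j.+1 = N by move: Hj jN; clear; lia.
  by have [_ ->] := h0 i Hi; have [_ ->] := hdof_bdry (dof p) i.
Qed.

Lemma has_dof_Y p c : has_dof p c -> Y M N p.
Proof.
move=> pc; split; first exact: traced_H0div pc.
by move=> [i j]; apply: (traced_RT0 pc); rewrite leq0n/=.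
Qed.

Lemma has_dof_exists c : exists p, has_dof p c.
Proof.
apply: traced_exists => [j _|i _]; [exact: vdof_bdry|exact: hdof_bdry].
Qed.

Lemma has_dof_lin p q c c' (s t : R) : has_dof p c -> has_dof q c' ->
  has_dof (fun x => s *: p x + t *: q x) (fun e => s * c e + t * c' e).
Proof.
move=> pc qc; apply: traced_eq (traced_lin s t pc qc) => // i j _ _.
- by rewrite vdof_lin.
- by rewrite hdof_lin.
Qed.

Lemma has_dofD p q c c' : has_dof p c -> has_dof q c' ->
  has_dof (fun x => p x + q x) (fun e => c e + c' e).
Proof.
move=> pc qc; have := has_dof_lin 1 1 pc qc.
under eq_fun do rewrite !scale1r.
by under [X in has_dof _ X]eq_fun do rewrite !mul1r.
Qed.

Lemma has_dofB p q c c' : has_dof p c -> has_dof q c' ->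
  has_dof (fun x => p x - q x) (fun e => c e - c' e).
Proof.
move=> pc qc; have := has_dof_lin 1 (-1) pc qc.
under eq_fun do rewrite scale1r scaleN1r.
by under [X in has_dof _ X]eq_fun do rewrite mul1r mulN1r.
Qed.

Lemma has_dofZ p c (s : R) : has_dof p c ->
  has_dof (fun x => s *: p x) (fun e => s * c e).
Proof.
move=> pc; have := has_dof_lin s 0 pc pc.
under eq_fun do rewrite scale0r addr0.
by under [X in has_dof _ X]eq_fun do rewrite mul0r addr0.
Qed.

Lemma has_dof0 : has_dof (fun=> 0) (fun=> 0).
Proof.
have [p pc] := has_dof_exists (fun=> 0).
have := has_dofZ 0 pc.
under eq_fun do rewrite scale0r.
by under [X in has_dof _ X]eq_fun do rewrite mul0r.
Qed.

Lemma has_dof_psi (e : E) : has_dof (psi e) (fun e' => (e' == e)%:R).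
Proof.
have [p pc] := has_dof_exists (fun e' => (e' == e)%:R).
have ex : [set p : field R | Y M N p /\ forall e', dof p e' = (e' == e)%:R] p.
  by split; [exact: has_dof_Y pc|rewrite (has_dofE pc)].
have [Yp dp] := getPex (ex_intro _ p ex).
have := Y_has_dof Yp; rewrite -/(psi e).
by rewrite (_ : dof (psi e) = (fun e' => (e' == e)%:R))//; apply/funext.
Qed.

Lemma has_dof_combine (P : pred E) c :
  has_dof (fun x => \sum_(e | P e) (c e *: psi e x)) (fun e => if P e then c e else 0).
Proof.
have H s : has_dof (fun x => \sum_(e <- s | P e) (c e *: psi e x))
    (fun e => \sum_(e' <- s | P e') c e' * (e == e')%:R).
  elim: s => [|e s IH].
    under eq_fun do rewrite big_nil.
    under [X in has_dof _ X]eq_fun do rewrite big_nil.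
    exact: has_dof0.
  under eq_fun do rewrite big_cons.
  under [X in has_dof _ X]eq_fun do rewrite big_cons.
  case: (P e) => //.
  exact: has_dofD (has_dofZ _ (has_dof_psi e)) IH.
have := H (index_enum E).
under [X in has_dof _ X]eq_fun => e.
  rewrite big_mkcond (bigD1 e)//= eqxx mulr1 big1 ?addr0.
    over.
  by move=> e' /negbTE e'e; rewrite eq_sym e'e mulr0 if_same.
by [].
Qed.

(** Divergences are only determined almost everywhere, so the elements of X occur
through their values up to null sets. *)
Definition pw_const (u : R * R -> R) (w : 'I_M * 'I_N -> R) :=
  mfun R (grid 0 M 0 N) u /\ forall T, ae_on (pixel T) u (fun=> w T).

Lemma pw_constD u u' w w' : pw_const u w -> pw_const u' w' ->
  pw_const (fun x => u x + u' x) (fun T => w T + w' T).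
Proof.
move=> [mu uw] [mu' uw']; split; first exact: measurable_funD.
by move=> T; apply: filterS2 (uw T) (uw' T) => x h h' Dx; rewrite h// h'.
Qed.

Lemma pw_constM u u' w w' : pw_const u w -> pw_const u' w' ->
  pw_const (fun x => u x * u' x) (fun T => w T * w' T).
Proof.
move=> [mu uw] [mu' uw']; split; first exact: measurable_funM.
by move=> T; apply: filterS2 (uw T) (uw' T) => x h h' Dx; rewrite h// h'.
Qed.

Lemma pw_constZ (s : R) u w : pw_const u w ->
  pw_const (fun x => s * u x) (fun T => s * w T).
Proof.
move=> [mu uw]; split; first by apply: measurable_funM.
by move=> T; apply: filterS (uw T) => x h Dx; rewrite h.
Qed.

Lemma mu2_pix i j : mu2 (pix i j) = 1%E.
Proof.
rewrite /pix /grid /box mu2X// !lebesgue_measure_itv/= !lte_fin !ltr_nat !ltnSn.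
by rewrite -!EFinB -EFinM -!natr1 !(addrC _ 1) !addrK mulr1.
Qed.

Lemma integral_pw_const u w : pw_const u w ->
  integral_on (Omega M N) u = \sum_T w T.
Proof.
move=> [mu uw].
have uw' i j (Hi : (i < M)%N) (Hj : (j < N)%N) := uw (Ordinal Hi, Ordinal Hj).
have muP i j : (i < M)%N -> (j < N)%N -> mfun R (pix i j) u.
  by move=> Hi Hj; apply: measurable_funS mu => //; apply: pix_sub.
rewrite OmegaE Rintegral_grid//; last first.
  move=> i j Hi Hj; apply: (ae_eq_integrable (measurable_pix i j) (muP i j Hi Hj) (uw' i j Hi Hj)).
  by apply: continuous_integrable_box => ?; exact: cvg_cst.
rewrite big_mkord; under eq_bigr do rewrite big_mkord.
rewrite pair_bigA/=; apply: eq_bigr => -[i j] _ /=.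
rewrite (ae_eq_Rintegral (measurable_pix i j) (muP i j (ltn_ord i) (ltn_ord j)) _ (uw (i, j)))//.
rewrite integral_onE (Rintegral_cst mu2 (measurable_pix i j) (w (i, j))).
by rewrite mu2_pix mulr1.
Qed.

Definition dofdiv c (T : 'I_M * 'I_N) : R := rt_div (vdof c) (hdof c) T.1 T.2.

Lemma dofdiv_lin c c' (s t : R) T :
  dofdiv (fun e => s * c e + t * c' e) T = s * dofdiv c T + t * dofdiv c' T.
Proof. rewrite /dofdiv /rt_div !vdof_lin !hdof_lin; ring. Qed.

Lemma dofdivD c c' T : dofdiv (fun e => c e + c' e) T = dofdiv c T + dofdiv c' T.
Proof.
have := dofdiv_lin c c' 1 1 T; rewrite !mul1r => <-; congr dofdiv.
by apply/funext => e; rewrite !mul1r.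
Qed.

Lemma dofdivZ c (s : R) T : dofdiv (fun e => s * c e) T = s * dofdiv c T.
Proof.
have := dofdiv_lin c c s 0 T; rewrite !mul0r addr0 => <-; congr dofdiv.
by apply/funext => e; rewrite mul0r addr0.
Qed.

Lemma dofdiv_sum c T : dofdiv c T = \sum_(e : E) c e * dofdiv (fun e' => (e' == e)%:R) T.
Proof.
have H s : dofdiv (fun e' => \sum_(e <- s) c e * (e' == e)%:R) T =
   \sum_(e <- s) c e * dofdiv (fun e' => (e' == e)%:R) T.
  elim: s => [|e s IH].
    transitivity (dofdiv (fun e => 0 * c e) T).
      by congr dofdiv; apply/funext => e; rewrite big_nil mul0r.
    by rewrite dofdivZ mul0r big_nil.
  rewrite big_cons -IH -dofdivZ -dofdivD; congr dofdiv.
  by apply/funext => e'; rewrite big_cons.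
rewrite -H; congr dofdiv; apply/funext => e.
rewrite (bigD1 e)//= eqxx mulr1 big1 ?addr0// => e' /negbTE.
by rewrite eq_sym => ->; rewrite mulr0.
Qed.

Lemma pw_const_div p c : has_dof p c -> pw_const (div (Omega M N) p) (dofdiv c).
Proof.
move=> pc; have [Hp _] := has_dof_Y pc; have wd := is_weak_div_div Hp.1.
split; first by case: wd => [[]].
by move=> [i j]; exact: (traced_weak_div pc wd (i := i) (j := j) (ltn_ord i) (ltn_ord j)).
Qed.

Lemma X_pw_const f : X M N f -> exists w, pw_const f w.
Proof.
move=> [[mf _] fT]; have [w wP] := choice fT; exists w; split=> // T.
by apply: eq_ae_on => x; exact: wP.
Qed.

Lemma JE (alpha : R) f w p c : pw_const f w -> has_dof p c ->
  J M N alpha f p = (2 * alpha)^-1 * \sum_T (dofdiv c T + alpha * w T) ^+ 2.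
Proof.
move=> fw pc; rewrite /J; congr (_ * _).
have h := pw_constD (pw_const_div pc) (pw_constZ alpha fw).
exact: integral_pw_const (pw_constM h h).
Qed.

Lemma innerYE p q c c' : has_dof p c -> has_dof q c' ->
  innerY M N p q = \sum_(e : E) c e * c' e.
Proof. by move=> pc qc; rewrite /innerY (has_dofE pc) (has_dofE qc). Qed.

(** Testing the adjoint with psi_e reads off its degree of freedom at e. *)
Lemma has_dof_div_adj u w : pw_const u w ->
  has_dof (div_adj M N u) (fun e => \sum_T w T * dofdiv (fun e' => (e' == e)%:R) T).
Proof.
move=> uw; set c := fun e => _.
have inX p : Y M N p -> innerX M N u (div (Omega M N) p) = \sum_(e : E) c e * dof p e.
  move=> /Y_has_dof pc; rewrite /innerX (integral_pw_const (pw_constM uw (pw_const_div pc))).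
  under eq_bigr do rewrite dofdiv_sum mulr_sumr.
  rewrite exchange_big/=; apply: eq_bigr => e _; rewrite mulr_suml.
  by apply: eq_bigr => T _; rewrite mulrCA mulrC.
have [r rc] := has_dof_exists c.
pose A := [set r : field R | Y M N r /\ forall p, Y M N p ->
  innerY M N r p = innerX M N u (div (Omega M N) p)].
have Ar : A r.
  split; first exact: has_dof_Y rc.
  by move=> p Yp; rewrite (innerYE rc (Y_has_dof Yp)) inX.
have [Yd dP] := getPex (ex_intro _ r Ar).
have := Y_has_dof Yd; rewrite -/(div_adj M N u).
rewrite (_ : dof (div_adj M N u) = c)//; apply/funext => e.
have Ype := has_dof_Y (has_dof_psi e).
have := dP _ Ype; rewrite inX// (innerYE (Y_has_dof Yd) (has_dof_psi e)).
rewrite (has_dofE (has_dof_psi e)).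
rewrite (bigD1 e)//= eqxx mulr1 big1 ?addr0 => [->|e' /negbTE ->]; last by rewrite mulr0.
by rewrite (bigD1 e)//= eqxx mulr1 big1 ?addr0// => e' /negbTE ->; rewrite mulr0.
Qed.

End Discrete.

(** * Variational inequalities in finite dimension *)
Section LinearAlgebra.
Context {R : realType}.

(** The linear term dominates for small t. *)
Lemma quadratic_ge0 (x y : R) : 0 <= y ->
  (forall t, 0 < t <= 1 -> 0 <= 2 * t * x + t ^+ 2 * y) -> 0 <= x.
Proof.
move=> y0 H; rewrite leNgt; apply/negP => x0.
have [xy|xy] := leP (y + 1) (- x).
  by have := H 1 ltac:(by rewrite ltr01 lexx); lra.
have y1 : 0 < y + 1 by lra.
(* Chosen so that t * (y + 1) = - x, which makes 2 * x + t * y negative. *)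
pose t := - x / (y + 1).
have t0 : 0 < t by apply: divr_gt0; lra.
have t1 : t <= 1 by rewrite /t ler_pdivrMr// mul1r ltW.
have tx : t * (y + 1) = - x by rewrite /t divfK// gt_eqF.
have := H t; rewrite t0 t1 => /(_ isT).
rewrite leNgt => /negP; apply.
have -> : 2 * t * x + t ^+ 2 * y = t * (x - t + (x + t * (y + 1))) by ring.
rewrite tx pmulr_rlt0//; lra.
Qed.

Variable I : finType.
Implicit Types u v w : I -> R.

Definition ip u v := \sum_i u i * v i.

Lemma ip_ge0 u : 0 <= ip u u.
Proof. by apply: sumr_ge0 => i _; rewrite -expr2 sqr_ge0. Qed.

Lemma ip_sqD u v (t : R) :
  ip (fun i => u i + t * v i) (fun i => u i + t * v i) =
  ip u u + 2 * t * ip u v + t ^+ 2 * ip v v.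
Proof.
rewrite /ip !mulr_sumr -!big_split/=; apply: eq_bigr => i _; ring.
Qed.

Lemma ip_sqrE u : ip u u = \sum_i u i ^+ 2.
Proof. by apply: eq_bigr => i _; rewrite expr2. Qed.

Lemma first_order_min u v :
  (forall t, 0 < t <= 1 -> ip u u <= ip (fun i => u i + t * v i) (fun i => u i + t * v i)) ->
  0 <= ip u v.
Proof.
move=> H; apply: (@quadratic_ge0 _ (ip v v)); first exact: ip_ge0.
by move=> t /H; rewrite ip_sqD -addrA lerDl.
Qed.

(** Dp and Dq are the residuals of two minimizers, B the divergence of the difference of
the minimizers and H that of the increment of the data.  The two hypotheses on signs are
the optimality conditions, each tested with the other minimizer. *)
Section Perturbation.
Variables (Dp Dq B H : I -> R).
Hypothesis DqE : forall i, Dq i = Dp i + B i + H i.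
Hypothesis vip : 0 <= ip Dp B.
Hypothesis viq : ip Dq B <= 0.
Let e i := Dq i - Dp i.

Let ee : ip e e <= ip e H.
Proof.
have -> : ip e e = ip Dq B - ip Dp B + ip e H.
  rewrite /ip -sumrB -big_split/=; apply: eq_bigr => i _.
  rewrite /e DqE; ring.
by move: vip viq; lra.
Qed.

Lemma perturbation_le : ip e e <= ip H H.
Proof.
have := ip_ge0 (fun i => H i + (-1) * e i).
rewrite ip_sqD; have -> : ip H e = ip e H by apply: eq_bigr => i _; rewrite mulrC.
have := ee; lra.
Qed.

Lemma perturbation_ge0 : 0 <= ip Dq H - ip Dp H.
Proof.
have <- : ip e H = ip Dq H - ip Dp H.
  by rewrite /ip -sumrB; apply: eq_bigr => i _; rewrite /e mulrBl.
exact: le_trans (ip_ge0 e) ee.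
Qed.

End Perturbation.
End LinearAlgebra.

(** * Subdomains and interface *)
Section Subdomains.
Context {R : realType}.
Implicit Types (p q : field R).

(** Extension by zero creates no jump, as the traces vanish on the boundary of the
smaller grid. *)
Lemma traced_extend a b c d a' b' c' d' p (v h : nat -> nat -> R) :
  (a' <= a)%N -> (a <= b)%N -> (b <= b')%N ->
  (c' <= c)%N -> (c <= d)%N -> (d <= d')%N ->
  traced a b c d p v h -> (forall x, ~ grid a b c d x -> p x = 0) ->
  exists v' h', traced a' b' c' d' p v' h'.
Proof.
move=> aa ab bb cc cd dd [m1 m2 pE v0 h0] p0.
pose v' i j := if (a <= i <= b)%N && (c <= j < d)%N then v i j else 0.
pose h' i j := if (a <= i < b)%N && (c <= j <= d)%N then h i j else 0.
exists v', h'.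
have ext (u : R * R -> R) : mfun R (grid a b c d) u ->
    (forall x, ~ grid a b c d x -> u x = 0) -> mfun R (grid a' b' c' d') u.
  move=> mu u0; rewrite (_ : u = u \_ (grid a b c d)).
    apply: measurable_funS measurableT _ _ => //.
    by apply/(measurable_restrictT _ _).1.
  apply/funext => x; rewrite patchE; case: ifPn => //.
  by rewrite notin_setE => /u0.
split.
- by apply: ext => // x /p0 ->.
- by apply: ext => // x /p0 ->.
- move=> i j Hi Hj x px.
  have [ij|] := boolP ((a <= i < b)%N && (c <= j < d)%N).
    have /andP[Hi' Hj'] := ij; rewrite (pE i j)// /v' /h'.
    have -> : (a <= i <= b)%N by lia.
    have -> : (a <= i.+1 <= b)%N by lia.
    have -> : (c <= j <= d)%N by lia.
    have -> : (c <= j.+1 <= d)%N by lia.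
    by rewrite Hi' Hj'/=.
  move=> ij; rewrite p0; last first.
    move=> /boxP[x1 x2 x3 x4]; case/boxP: px => [x5 x6 x7 x8].
    move/negP: ij; apply.
    have := lt_trans x1 x6; have := lt_trans x5 x2.
    have := lt_trans x3 x8; have := lt_trans x7 x4.
    by rewrite !ltr_nat; lia.
  have E1 : v' i j = 0.
    rewrite /v'; case: ifP => // /andP[Hi' Hj'].
    have -> : i = b by lia.
    by have [] := v0 j Hj'.
  have E2 : v' i.+1 j = 0.
    rewrite /v'; case: ifP => // /andP[Hi' Hj'].
    have -> : i.+1 = a by lia.
    by have [] := v0 j Hj'.
  have E3 : h' i j = 0.
    rewrite /h'; case: ifP => // /andP[Hi' Hj'].
    have -> : j = d by lia.
    by have [] := h0 i Hi'.
  have E4 : h' i j.+1 = 0.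
    rewrite /h'; case: ifP => // /andP[Hi' Hj'].
    have -> : j.+1 = c by lia.
    by have [] := h0 i Hi'.
  by rewrite E1 E2 E3 E4 !subrr !mul0r !addr0.
- move=> j Hj; split; rewrite /v'; case: ifP => // /andP[Hi' Hj'].
  + have -> : a' = a by lia.
    by have [] := v0 j Hj'.
  + have -> : b' = b by lia.
    by have [] := v0 j Hj'.
- move=> i Hi; split; rewrite /h'; case: ifP => // /andP[Hi' Hj'].
  + have -> : c' = c by lia.
    by have [] := h0 i Hi'.
  + have -> : d' = d by lia.
    by have [] := h0 i Hi'.
Qed.

Lemma RT0_lin D p q (s t : R) : RT0 D p -> RT0 D q ->
  RT0 D (fun x => s *: p x + t *: q x).
Proof.
move=> [a1 [b1 [a2 [b2 pE]]]] [a1' [b1' [a2' [b2' qE]]]].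
exists (s * a1 + t * a1'), (s * b1 + t * b1'), (s * a2 + t * a2'), (s * b2 + t * b2').
move=> x Dx; rewrite pE// qE//.
by apply: injective_projections; rewrite /= /GRing.scale/=; ring.
Qed.

Variables (K d : nat).
Let M := (K * d)%N.
Implicit Types s : 'I_K * 'I_K.
Notation YG := (@Y_Gamma R M M K d).
Notation onG := (@edge_on_Gamma R M M K d).

Let Ksub (i : 'I_K) : (i.+1 * d <= M)%N.
Proof. by rewrite leq_mul2r ltn_ord orbT. Qed.

Let Kle (i : 'I_K) : (i * d <= i.+1 * d)%N.
Proof. by rewrite leq_mul2r leqnSn orbT. Qed.

Lemma Y_sub_traced s p : Y_sub M M d s p -> exists v h,
  traced (s.1 * d) (s.1.+1 * d) (s.2 * d) (s.2.+1 * d) p v h.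
Proof.
move=> [Hp rt _]; apply: H0div_traced => // i j Hi Hj.
have iM : (i < M)%N by apply: leq_trans (Ksub s.1); case/andP: Hi.
have jM : (j < M)%N by apply: leq_trans (Ksub s.2); case/andP: Hj.
exact: (rt (Ordinal iM, Ordinal jM) (pix_sub Hi Hj)).
Qed.

Lemma Y_sub_Y s p : Y_sub M M d s p -> Y M M p.
Proof.
move=> Yp; have [v [h pvh]] := Y_sub_traced Yp; have [_ _ p0] := Yp.
have [v' [h' pvh']] := traced_extend (leq0n _) (Kle s.1) (Ksub s.1) (leq0n _)
  (Kle s.2) (Ksub s.2) pvh p0.
split; first exact: traced_H0div pvh'.
by move=> [i j]; exact: (traced_RT0 pvh' (i := i) (j := j) (ltn_ord i) (ltn_ord j)).
Qed.

Lemma Y_sub_lin s p q (x y : R) : Y_sub M M d s p -> Y_sub M M d s q ->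
  Y_sub M M d s (fun z => x *: p z + y *: q z).
Proof.
move=> Yp Yq; have [v [h pvh]] := Y_sub_traced Yp; have [v' [h' qvh]] := Y_sub_traced Yq.
have [_ rp p0] := Yp; have [_ rq q0] := Yq.
split.
- exact: traced_H0div (traced_lin x y pvh qvh).
- by move=> T Ts; apply: RT0_lin; [exact: rp|exact: rq].
- by move=> z nz; rewrite p0// q0// !scaler0 addr0.
Qed.

Lemma Y_sub0 s : Y_sub M M d s ((fun=> 0) : field R).
Proof.
split => //; last by move=> T _; exists 0, 0, 0, 0 => x _; rewrite !mul0r addr0.
have [p pP] := @traced_exists R (s.1 * d) (s.1.+1 * d) (s.2 * d) (s.2.+1 * d)
  (fun _ _ => 0) (fun _ _ => 0) (fun _ _ => conj erefl erefl) (fun _ _ => conj erefl erefl).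
have := traced_lin 0 0 pP pP.
under eq_fun do rewrite !scale0r addr0.
exact: traced_H0div.
Qed.

Lemma C_sub_convex s p q (t : R) : 0 <= t <= 1 -> C_sub M M d s p -> C_sub M M d s q ->
  C_sub M M d s (fun z => (1 - t) *: p z + t *: q z).
Proof.
move=> /andP[t0 t1] [Yp Cp] [Yq Cq]; split; first exact: Y_sub_lin.
move=> e es.
have dp := Y_has_dof (Y_sub_Y Yp); have dq := Y_has_dof (Y_sub_Y Yq).
rewrite (has_dofE (has_dof_lin (1 - t) t dp dq)).
have := Cp e es; have := Cq e es; rewrite !ler_norml => /andP[? ?] /andP[? ?].
by apply/andP; split; nra.
Qed.

Lemma C_sub0 s : C_sub M M d s ((fun=> 0) : field R).
Proof.
split; first exact: Y_sub0.
by move=> e _; rewrite (has_dofE (has_dof0 M M)) normr0.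
Qed.

Lemma C_I_convex p q (t : R) : 0 <= t <= 1 -> C_I M M K d p -> C_I M M K d q ->
  C_I M M K d (fun z => (1 - t) *: p z + t *: q z).
Proof.
move=> t01 [ps psC ->] [qs qsC ->].
exists (fun s z => (1 - t) *: ps s z + t *: qs s z); first by move=> s; exact: C_sub_convex.
by apply/funext => z; rewrite big_split/= -!scaler_sumr.
Qed.

Lemma C_I0 : C_I M M K d ((fun=> 0) : field R).
Proof.
exists (fun _ _ => 0); first by move=> s; exact: C_sub0.
by apply/funext => z; rewrite big1.
Qed.

Lemma C_I_Y_I p : C_I M M K d p -> Y_I M M K d p.
Proof. by move=> [ps psC ->]; exists ps => // s; have [] := psC s. Qed.

Lemma C_I_has_dof p : C_I M M K d p -> has_dof p (dof p : edge M M -> R).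
Proof.
move=> [ps psC ->]; apply: Y_has_dof.
suff [c cP] : exists c : edge M M -> R, has_dof (fun x => \sum_s ps s x) c by exact: has_dof_Y cP.
elim: (index_enum _) => [|s r [c cP]].
  by exists (fun=> 0); under eq_fun do rewrite big_nil; exact: has_dof0.
have dps := Y_has_dof (Y_sub_Y (psC s).1).
exists (fun e => dof (ps s) e + c e).
by under eq_fun do rewrite big_cons; exact: has_dofD.
Qed.

(** The infimum is finite because 0 lies in C_I, so a minimizer satisfies the
constraint. *)
Lemma is_H_I_min alpha f pG pI : is_H_I M M K d alpha f pG pI ->
  C_I M M K d pI /\ forall q, C_I M M K d q ->
  J M M alpha f (fun x => pI x + pG x) <= J M M alpha f (fun x => q x + pG x).
Proof.
move=> [_ H].
suff gen (F : field R -> R) :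
    (forall q, Y_I M M K d q ->
      ((F pI)%:E + chi (C_I M M K d) pI <= (F q)%:E + chi (C_I M M K d) q)%E) ->
    C_I M M K d pI /\ forall q, C_I M M K d q -> F pI <= F q.
  exact: (gen (fun q => J M M alpha f (fun x => q x + pG x)) H).
move=> {}H.
have chi0 q : C_I M M K d q -> chi (C_I M M K d) q = 0%E :> \bar R.
  by move=> Cq; rewrite /chi; case: asboolP.
have CI : C_I M M K d pI.
  apply: contrapT => nC; have := H _ (C_I_Y_I C_I0).
  have -> : chi (C_I M M K d) pI = +oo%E :> \bar R by rewrite /chi; case: asboolP.
  by rewrite (chi0 _ C_I0) adde0 addey// leye_eq.
split=> // q Cq; have := H q (C_I_Y_I Cq).
by rewrite (chi0 _ CI) (chi0 _ Cq) !adde0 lee_fin.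
Qed.

Lemma boundary_box (a b c e : R) x : boundary (box a b c e) x ->
  [/\ a <= x.1 <= b, c <= x.2 <= e & ~ box a b c e x].
Proof.
move=> [cx ix].
have cl : closed (`[a, b] `*` `[c, e]).
  apply: compact_closed; first exact: norm_hausdorff.
  by apply: compact_setX; exact: segment_compact.
have : (`[a, b] `*` `[c, e]) x.
  rewrite ((closure_id _).1 cl); apply: closure_subset cx => y /boxP[? ? ? ?].
  by split; rewrite /= in_itv/=; apply/andP; split; exact: ltW.
move=> [/=]; rewrite !in_itv/= => -> ->; split => // bx; apply: ix.
by have := @open_box R a b c e; rewrite openE; exact.
Qed.

Lemma dvdn_between n (i : nat) : (0 < d)%N -> (n * d <= i <= n.+1 * d)%N ->
  ~ (n * d < i < n.+1 * d)%N -> (d %| i)%N.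
Proof.
move=> d0 /andP[h1 h2] h3.
have [->|e1] := eqVneq i (n * d)%N; first exact: dvdn_mull.
have [->|e2] := eqVneq i (n.+1 * d)%N; first exact: dvdn_mull.
by exfalso; apply: h3; rewrite !ltn_neqAle h1 h2 e2 eq_sym e1.
Qed.

Lemma nat_le_half (n j : nat) : (n%:R <= j%:R + 2^-1 :> R) -> (n <= j)%N.
Proof.
move=> h; rewrite -ltnS -(ltr_nat R) -natr1; lra.
Qed.

Lemma nat_gt_half (n j : nat) : (j%:R + 2^-1 <= n%:R :> R) -> (j < n)%N.
Proof. by move=> h; rewrite -(ltr_nat R); lra. Qed.

(** The midpoint of the edge is not at a corner of a subdomain: if it lies on the boundary of
a subdomain, the line carrying the edge carries a side of that subdomain. *)
Lemma on_Gamma_v (i : 'I_M.-1) (j : 'I_M) : (0 < d)%N ->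
  onG (inl (i, j)) -> (d %| i.+1)%N.
Proof.
have jj : j.+1%:R = j%:R + 1 :> R by rewrite natr1.
move=> d0 /asboolP sub.
have /sub[s [t [_ [/boundary_box[/=]]]]] :
    @edge_set R M M (inl (i, j)) (i.+1%:R, j%:R + 2^-1).
  by split=> //=; rewrite in_itv/=; apply/andP; split; lra.
rewrite !ler_nat => h1 /andP[h2 h3] h4 _.
apply: (dvdn_between d0 h1) => /andP[h5 h6]; apply: h4; apply/boxP; split => /=.
- by rewrite ltr_nat.
- by rewrite ltr_nat.
- by have := nat_le_half h2; rewrite -(ler_nat R); lra.
- by have := nat_gt_half h3; rewrite -(ler_nat R); lra.
Qed.

Lemma on_Gamma_h (i : 'I_M) (j : 'I_M.-1) : (0 < d)%N ->
  onG (inr (i, j)) -> (d %| j.+1)%N.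
Proof.
have jj : i.+1%:R = i%:R + 1 :> R by rewrite natr1.
move=> d0 /asboolP sub.
have /sub[s [t [_ [/boundary_box[/=]]]]] :
    @edge_set R M M (inr (i, j)) (i%:R + 2^-1, j.+1%:R).
  by split=> //=; rewrite in_itv/=; apply/andP; split; lra.
rewrite !ler_nat => /andP[h2 h3] h1 h4 _.
apply: (dvdn_between d0 h1) => /andP[h5 h6]; apply: h4; apply/boxP; split => /=.
- by have := nat_le_half h2; rewrite -(ler_nat R); lra.
- by have := nat_gt_half h3; rewrite -(ler_nat R); lra.
- by rewrite ltr_nat.
- by rewrite ltr_nat.
Qed.

Section NormBound.
Variable c : edge M M -> R.
Hypotheses (d2 : (2 <= d)%N) (cG : forall e, ~~ onG e -> c e = 0).

Lemma vdof_Gamma i j : vdof c i j != 0 -> (d %| i)%N.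
Proof.
rewrite /vdof; case: i => [|i]; first by rewrite dvdn0.
case: insubP => [i0 _ <-|]; last by rewrite eqxx.
case: insubP => [j0 _ _|]; last by rewrite eqxx.
move=> c0; apply: (@on_Gamma_v i0 j0); first exact: ltnW.
by apply: contraNT c0 => /cG ->.
Qed.

Lemma hdof_Gamma i j : hdof c i j != 0 -> (d %| j)%N.
Proof.
rewrite /hdof; case: j => [|j]; first by rewrite dvdn0.
case: insubP => [i0 _ _|]; last by rewrite eqxx.
case: insubP => [j0 _ <-|]; last by rewrite eqxx.
move=> c0; apply: (@on_Gamma_h i0 j0); first exact: ltnW.
by apply: contraNT c0 => /cG ->.
Qed.

Let not_both i : (d %| i)%N -> (d %| i.+1)%N -> False.
Proof.
move=> di; rewrite -addn1 (dvdn_addr _ di) dvdn1 => /eqP d1.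
by move: d2; rewrite d1.
Qed.

Let vv i j : vdof c i j * vdof c i.+1 j = 0.
Proof.
have [->|v1] := eqVneq (vdof c i j) 0; first by rewrite mul0r.
have [->|v2] := eqVneq (vdof c i.+1 j) 0; first by rewrite mulr0.
by case: (not_both (vdof_Gamma v1) (vdof_Gamma v2)).
Qed.

Let hh i j : hdof c i j * hdof c i j.+1 = 0.
Proof.
have [->|v1] := eqVneq (hdof c i j) 0; first by rewrite mul0r.
have [->|v2] := eqVneq (hdof c i j.+1) 0; first by rewrite mulr0.
by case: (not_both (hdof_Gamma v1) (hdof_Gamma v2)).
Qed.

(** As d >= 2, at most one of two consecutive parallel edges lies on Gamma, so the cross
term of their two values vanishes.  A first factor 2 comes from adding the horizontal and the
vertical differences, a second one from each edge belonging to two pixels. *)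
Lemma dofdiv_bound : \sum_T dofdiv c T ^+ 2 <= 4 * \sum_e c e ^+ 2.
Proof.
have [M0|M0] := posnP M.
  rewrite big1 => [|[i j] _]; last by have := ltn_ord i; rewrite {2}M0.
  by rewrite mulr_ge0// sumr_ge0// => e _; rewrite sqr_ge0.
have ptw T : dofdiv c T ^+ 2 <=
  2 * (vdof c T.1 T.2 ^+ 2 + vdof c T.1.+1 T.2 ^+ 2) +
  2 * (hdof c T.1 T.2 ^+ 2 + hdof c T.1 T.2.+1 ^+ 2).
  rewrite /dofdiv /rt_div; have := vv T.1 T.2; have := hh T.1 T.2.
  move: (vdof _ _ _) (vdof _ _ _) (hdof _ _ _) (hdof _ _ _) => x1 x2 y1 y2 hy hx.
  have := sqr_ge0 ((x2 - x1) - (y2 - y1)); rewrite !expr2; nra.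
apply: le_trans (ler_sum _ (fun T _ => ptw T)) _.
have vsum (f : nat -> R) : f 0%N = 0 -> f M = 0 ->
   \sum_(i < M) f i = \sum_(i < M.-1) f i.+1 /\ \sum_(i < M) f i.+1 = \sum_(i < M.-1) f i.+1.
  move=> f0 fM; rewrite -!(big_mkord xpredT f) -!(big_mkord xpredT (fun i => f i.+1)).
  rewrite -{1 3}(prednK M0) big_nat_recl// f0 add0r; split=> //.
  by rewrite big_nat_recr//= prednK// fM addr0.
have vE (j : 'I_M) : \sum_(i < M) (vdof c i j ^+ 2 + vdof c i.+1 j ^+ 2) =
    2 * \sum_(i < M.-1) c (inl (i, j)) ^+ 2.
  have [||E1 E2] := @vsum (fun i => vdof c i j ^+ 2).
  - by have [-> _] := vdof_bdry c j; rewrite expr0n.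
  - by have [_ ->] := vdof_bdry c j; rewrite expr0n.
  rewrite big_split/= E1 E2 mulr_natl mulr2n.
  by congr (_ + _); apply: eq_bigr => i _; rewrite vdof_edge.
have hE (i : 'I_M) : \sum_(j < M) (hdof c i j ^+ 2 + hdof c i j.+1 ^+ 2) =
    2 * \sum_(j < M.-1) c (inr (i, j)) ^+ 2.
  have [||E1 E2] := @vsum (fun j => hdof c i j ^+ 2).
  - by have [-> _] := hdof_bdry c i; rewrite expr0n.
  - by have [_ ->] := hdof_bdry c i; rewrite expr0n.
  rewrite big_split/= E1 E2 mulr_natl mulr2n.
  by congr (_ + _); apply: eq_bigr => j _; rewrite hdof_edge.
rewrite big_split/= -!mulr_sumr.
rewrite -(pair_bigA _ (fun i j : 'I_M => vdof c i j ^+ 2 + vdof c i.+1 j ^+ 2))/=.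
rewrite -(pair_bigA _ (fun i j : 'I_M => hdof c i j ^+ 2 + hdof c i j.+1 ^+ 2))/=.
rewrite exchange_big/= (eq_bigr _ (fun j _ => vE j)) (eq_bigr _ (fun j _ => hE j)).
rewrite -!mulr_sumr big_sumType/=.
have -> : \sum_(e : 'I_M.-1 * 'I_M) c (inl e) ^+ 2 =
    \sum_(i < M.-1) \sum_(j < M) c (inl (i, j)) ^+ 2.
  by rewrite pair_bigA; apply: eq_bigr => -[].
have -> : \sum_(e : 'I_M * 'I_M.-1) c (inr e) ^+ 2 =
    \sum_(i < M) \sum_(j < M.-1) c (inr (i, j)) ^+ 2.
  by rewrite pair_bigA; apply: eq_bigr => -[].
rewrite [X in _ <= 4 * (X + _)]exchange_big/=; lra.
Qed.

End NormBound.

End Subdomains.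

(** * The gradient of the interface functional *)
Section Gradient.
Context {R : realType}.
Variables (K d : nat).
Hypothesis d2 : (2 <= d)%N.
Let M := (K * d)%N.
Variables (alpha : R) (f : R * R -> R) (w : 'I_M * 'I_M -> R).
Hypotheses (alpha0 : 0 < alpha) (fw : pw_const f w).
Variable H_I : field R -> field R.
Hypothesis hH_I : forall pG, Y_Gamma M M K d pG -> is_H_I M M K d alpha f pG (H_I pG).
Notation YG := (@Y_Gamma R M M K d).
Notation onG := (@edge_on_Gamma R M M K d).
Notation E := (edge M M).
Notation dofM := (@dof R M M).
Implicit Types (p q pG qG h : field R).

Lemma Y_Gamma_has_dof pG : YG pG -> has_dof pG (dofM pG).
Proof.
move=> [c _ <-]; have h := has_dof_combine onG c.
by rewrite (has_dofE h).
Qed.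

Lemma Y_Gamma_supp pG (e : E) : YG pG -> ~~ onG e -> dofM pG e = 0.
Proof.
by move=> [c _ <-] eG; rewrite (has_dofE (has_dof_combine onG c)) (negbTE eG).
Qed.

Lemma Y_GammaD p h : YG p -> YG h -> YG (fun x => p x + h x).
Proof.
move=> [c _ <-] [c' _ <-]; exists (fun e => c e + c' e) => //.
apply/funext => x; rewrite /combine_Gamma -big_split/=.
by apply: eq_bigr => e _; rewrite scalerDl.
Qed.

Let res q pG T : R := dofdiv (fun e => dofM q e + dofM pG e) T + alpha * w T.
Let D pG := res (H_I pG) pG.
Let diff pG qG T := dofdiv (fun e => dofM qG e - dofM pG e) T.

Let C_I_dof q : C_I M M K d q -> has_dof q (dofM q).
Proof. exact: C_I_has_dof. Qed.

Let J_res q pG : C_I M M K d q -> YG pG ->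
  J M M alpha f (fun x => q x + pG x) = (2 * alpha)^-1 * ip (res q pG) (res q pG).
Proof.
move=> Cq YpG; rewrite ip_sqrE.
exact: JE fw (has_dofD (C_I_dof Cq) (Y_Gamma_has_dof YpG)).
Qed.

Let H_C pG : YG pG -> C_I M M K d (H_I pG).
Proof. by move=> YpG; have [] := is_H_I_min (hH_I YpG). Qed.

Let res_min pG q : YG pG -> C_I M M K d q ->
  ip (D pG) (D pG) <= ip (res q pG) (res q pG).
Proof.
move=> YpG Cq; have [CH /(_ q Cq)] := is_H_I_min (hH_I YpG).
rewrite !J_res// ler_pM2l// invr_gt0; move: alpha0; lra.
Qed.

Let res_variational pG q : YG pG -> C_I M M K d q ->
  0 <= ip (D pG) (diff (H_I pG) q).
Proof.
move=> YpG Cq; apply: first_order_min => t /andP[t0 t1].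
have CH := H_C YpG.
have t01 : 0 <= t <= 1 by rewrite (ltW t0).
apply: le_trans (res_min YpG (C_I_convex t01 CH Cq)) _.
rewrite le_eqVlt; apply/orP; left; apply/eqP; apply: eq_bigr => T _.
suff -> : res (fun z => (1 - t) *: H_I pG z + t *: q z) pG T =
  D pG T + t * diff (H_I pG) q T by [].
rewrite /D /res (has_dofE (has_dof_lin (1 - t) t (C_I_dof CH) (C_I_dof Cq))).
rewrite [RHS]addrAC; congr (_ + _); rewrite /diff -dofdivZ -dofdivD; congr dofdiv.
apply/funext => e; ring.
Qed.

Section TwoPoints.
Variables pG qG : field R.
Hypotheses (YpG : YG pG) (YqG : YG qG).
Let B := diff (H_I pG) (H_I qG).
Let H := diff pG qG.

Let DqE T : D qG T = D pG T + B T + H T.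
Proof.
rewrite /D /res /B /H /diff !(addrAC _ (alpha * w T)); congr (_ + _).
rewrite -!dofdivD; congr dofdiv; apply/funext => e; ring.
Qed.

Let vip : 0 <= ip (D pG) B.
Proof. by apply: res_variational => //; exact: H_C. Qed.

Let viq : ip (D qG) B <= 0.
Proof.
have := res_variational YqG (H_C YpG).
have -> : ip (D qG) (diff (H_I qG) (H_I pG)) = - ip (D qG) B.
  rewrite /ip -sumrN; apply: eq_bigr => T _; rewrite -mulrN; congr (_ * _).
  rewrite /B /diff -mulN1r -dofdivZ; congr dofdiv; apply/funext => e; ring.
by rewrite oppr_ge0.
Qed.

Lemma residual_lipschitz :
  ip (fun T => D qG T - D pG T) (fun T => D qG T - D pG T) <= ip H H.
Proof. exact: perturbation_le DqE vip viq. Qed.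

(** The minimizer at each of the two points is a competitor at the other one.  The terms
linear in H differ by <D qG - D pG, H>, which has the favourable sign. *)
Lemma J_Gamma_estimate :
  `|J_Gamma M M alpha f H_I qG - J_Gamma M M alpha f H_I pG - alpha^-1 * ip (D pG) H|
  <= (2 * alpha)^-1 * ip H H.
Proof.
have up : ip (D qG) (D qG) <= ip (D pG) (D pG) + 2 * ip (D pG) H + ip H H.
  apply: le_trans (res_min YqG (H_C YpG)) _.
  have := ip_sqD (D pG) H 1; rewrite mulr1 expr1n mul1r => <-.
  rewrite le_eqVlt; apply/orP; left; apply/eqP; apply: eq_bigr => T _.
  suff -> : res (H_I pG) qG T = D pG T + 1 * H T by [].
  rewrite mul1r /D /res /H /diff [RHS]addrAC -dofdivD; congr (dofdiv _ _ + _).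
  apply/funext => e; ring.
have lo : ip (D pG) (D pG) <= ip (D qG) (D qG) - 2 * ip (D qG) H + ip H H.
  apply: le_trans (res_min YpG (H_C YqG)) _.
  have := ip_sqD (D qG) H (-1); rewrite mulrN1 sqrrN expr1n mul1r mulNr => <-.
  rewrite le_eqVlt; apply/orP; left; apply/eqP; apply: eq_bigr => T _.
  suff -> : res (H_I qG) pG T = D qG T + -1 * H T by [].
  rewrite /D /res /H /diff [RHS]addrAC -dofdivZ -dofdivD; congr (dofdiv _ _ + _).
  apply/funext => e; ring.
have mono := perturbation_ge0 DqE vip viq.
rewrite /J_Gamma !J_res//; try exact: H_C.
rewrite -/(D pG) -/(D qG) !invfM.
have -> : 2^-1 / alpha * ip (D qG) (D qG) - 2^-1 / alpha * ip (D pG) (D pG) -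
   alpha^-1 * ip (D pG) H =
   2^-1 / alpha * (ip (D qG) (D qG) - ip (D pG) (D pG) - 2 * ip (D pG) H) by field; rewrite gt_eqF.
have a0 : 0 <= 2^-1 / alpha by rewrite divr_ge0// ltW.
rewrite normrM ger0_norm// ler_wpM2l// ler_norml; apply/andP; split; lra.
Qed.

End TwoPoints.

Definition grad_dof pG (e : E) : R :=
  if onG e then alpha^-1 * \sum_T D pG T * dofdiv (fun e' => (e' == e)%:R) T else 0.

Lemma has_dof_grad pG : YG pG ->
  has_dof (grad_J_Gamma M M K d alpha f H_I pG) (grad_dof pG).
Proof.
move=> YpG; rewrite /grad_J_Gamma /restr_Gamma.
have hu := pw_constD (pw_const_div (has_dofD (C_I_dof (H_C YpG)) (Y_Gamma_has_dof YpG)))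
  (pw_constZ alpha fw).
rewrite (has_dofE (has_dofZ alpha^-1 (has_dof_div_adj hu))).
exact: has_dof_combine.
Qed.

Let sum_onG (c h : E -> R) : (forall e, ~~ onG e -> h e = 0) ->
  \sum_e (if onG e then c e else 0) * h e = \sum_e c e * h e.
Proof.
move=> h0; apply: eq_bigr => e _; case: ifPn => // /h0 ->.
by rewrite !mulr0.
Qed.

Lemma grad_dof_pairing pG (c : E -> R) : (forall e, ~~ onG e -> c e = 0) ->
  \sum_e grad_dof pG e * c e = alpha^-1 * ip (D pG) (dofdiv c).
Proof.
move=> c0; rewrite sum_onG// /ip mulr_sumr.
under [RHS]eq_bigr do rewrite dofdiv_sum !mulr_sumr.
rewrite exchange_big/=; apply: eq_bigr => e _; rewrite mulr_sumr mulr_suml.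
by apply: eq_bigr => T _; ring.
Qed.

(** [J_Gamma_estimate] and [dofdiv_bound] bound the remainder by 2 / alpha times the square
of the norm of h. *)
Lemma gradient_J_Gamma pG : YG pG ->
  has_gradient M M K d (J_Gamma M M alpha f H_I) pG
    (grad_J_Gamma M M K d alpha f H_I pG).
Proof.
move=> YpG; split; first by exists (dof (fun x => alpha^-1 *: div_adj M M (fun y =>
  div (Omega M M) (fun z => H_I pG z + pG z) y + alpha * f y) x)).
move=> eps eps0; exists (eps * alpha / 2); first by rewrite divr_gt0// mulr_gt0.
move=> h Yh; have Yph := Y_GammaD YpG Yh.
have dh := Y_Gamma_has_dof Yh.
rewrite /normY (innerYE dh dh); set n2 := \sum_e _ => nle.
rewrite (innerYE (has_dof_grad YpG) dh) grad_dof_pairing; last first.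
  by move=> e; exact: Y_Gamma_supp.
have HE : diff pG (fun x => pG x + h x) = dofdiv (dofM h).
  apply/funext => T; congr dofdiv; apply/funext => e.
  by rewrite (has_dofE (has_dofD (Y_Gamma_has_dof YpG) dh)) addrAC subrr add0r.
have := J_Gamma_estimate YpG Yph; rewrite HE => /le_trans; apply.
have n20 : 0 <= n2 by apply: sumr_ge0 => e _; rewrite -expr2 sqr_ge0.
have bd : ip (dofdiv (dofM h)) (dofdiv (dofM h)) <= 4 * n2.
  rewrite ip_sqrE (_ : n2 = \sum_e dofM h e ^+ 2); last by apply: eq_bigr => e _; rewrite expr2.
  by apply: dofdiv_bound => // e; exact: Y_Gamma_supp.
have a0 : 0 <= (2 * alpha)^-1 by rewrite invr_ge0; move: alpha0; lra.
apply: le_trans (ler_wpM2l a0 bd) _.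
rewrite -{1}(sqr_sqrtr n20); move: nle (sqrtr_ge0 n2); set r := Num.sqrt n2 => rle r0.
have -> : (2 * alpha)^-1 * (4 * r ^+ 2) = (2 / alpha * r) * r by field; rewrite gt_eqF.
by rewrite ler_wpM2r// mulrAC ler_pdivrMr//; move: rle; lra.
Qed.

(** The increment g of the gradient satisfies alpha |g|^2 = <e, div g> <= 2 |e| |g|, where e
is the increment of the residual, and |e| <= 2 |c|. *)
Lemma lipschitz_grad_J_Gamma pG qG : YG pG -> YG qG ->
  normY M M (fun x => grad_J_Gamma M M K d alpha f H_I pG x
                      - grad_J_Gamma M M K d alpha f H_I qG x)
  <= 4 / alpha * normY M M (fun x => pG x - qG x).
Proof.
move=> YpG YqG.
have dg := has_dofB (has_dof_grad YpG) (has_dof_grad YqG).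
have dpq := has_dofB (Y_Gamma_has_dof YpG) (Y_Gamma_has_dof YqG).
rewrite /normY (innerYE dg dg) (innerYE dpq dpq).
set g := fun e : E => grad_dof pG e - grad_dof qG e.
set c := fun e : E => dofM pG e - dofM qG e.
rewrite -/(ip g g) -/(ip c c).
have g0 e : ~~ onG e -> g e = 0.
  by move=> eG; rewrite /g /grad_dof (negbTE eG) subrr.
have c0 e : ~~ onG e -> c e = 0.
  by move=> eG; rewrite /c !Y_Gamma_supp// subrr.
pose e T := D pG T - D qG T.
have eH : ip e e <= ip (dofdiv c) (dofdiv c) by exact: residual_lipschitz.
have gg : ip g g = alpha^-1 * ip e (dofdiv g).
  have -> : ip g g = \sum_i grad_dof pG i * g i - \sum_i grad_dof qG i * g i.
    by rewrite -sumrB; apply: eq_bigr => i _; rewrite mulrBl.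
  rewrite !grad_dof_pairing// -mulrBr; congr (_ * _).
  by rewrite /ip -sumrB; apply: eq_bigr => T _; rewrite mulrBl.
have bg : ip (dofdiv g) (dofdiv g) <= 4 * ip g g.
  by rewrite !ip_sqrE; exact: dofdiv_bound.
have bc : ip (dofdiv c) (dofdiv c) <= 4 * ip c c.
  by rewrite !ip_sqrE; exact: dofdiv_bound.
have eg : ip e (dofdiv g) = alpha * ip g g by rewrite gg mulVKf// gt_eqF.
have key : ip g g <= (4 / alpha) ^+ 2 * ip c c.
  (* The weight 4 / alpha is the optimal one in Young's inequality for <e, div g>. *)
  have := ip_ge0 (fun T => dofdiv g T + (- (4 / alpha)) * e T).
  rewrite ip_sqD (_ : ip (dofdiv g) e = alpha * ip g g); last first.
    by rewrite -eg; apply: eq_bigr => T _; rewrite mulrC.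
  have -> : 2 * - (4 / alpha) * (alpha * ip g g) = - 8 * ip g g by field; rewrite gt_eqF.
  rewrite sqrrN => h.
  have ec : (4 / alpha) ^+ 2 * ip e e <= (4 / alpha) ^+ 2 * (4 * ip c c).
    by rewrite ler_wpM2l ?sqr_ge0//; exact: le_trans eH bc.
  lra.
have a0 : 0 <= 4 / alpha by rewrite divr_ge0// ltW.
rewrite -[4 / alpha]ger0_norm// -sqrtr_sqr -sqrtrM ?sqr_ge0//.
exact: ler_wsqrtr.
Qed.

End Gradient.

Theorem corollary3p4 (R : realType) (M N K d : nat)
    (hK : (0 < K)%N) (hd : (2 <= d)%N)
    (hM : M = (K * d)%N) (hN : N = (K * d)%N)
    (alpha : R) (halpha : 0 < alpha)
    (f : R * R -> R) (hf : X M N f)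
    (H_I : field R -> field R)
    (hH_I : forall pG, Y_Gamma M N K d pG -> is_H_I M N K d alpha f pG (H_I pG)) :
  (forall pG, Y_Gamma M N K d pG ->
     has_gradient M N K d (J_Gamma M N alpha f H_I) pG
       (grad_J_Gamma M N K d alpha f H_I pG)) /\
  (forall pG qG, Y_Gamma M N K d pG -> Y_Gamma M N K d qG ->
     normY M N (fun x => grad_J_Gamma M N K d alpha f H_I pG x
                         - grad_J_Gamma M N K d alpha f H_I qG x)
     <= 4 / alpha * normY M N (fun x => pG x - qG x)).
Proof.
subst M N; have [w fw] := X_pw_const hf.
split; first exact: (gradient_J_Gamma hd halpha fw hH_I).
exact: (lipschitz_grad_J_Gamma hd halpha fw hH_I).
Qed.
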